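(* (Stability II) Let $\Omega\subset\mathbb{R}^d$ be a bounded, open domain, $\delta_0>0$, and let $\delta=M_0h_{\max}$ with $M_0>0$ fixed. For any $\delta\in(0,\delta_0]$ and any $u\in S(\square\cap\Omega)$, $$\left| r^h_\Omega(-\mathcal{L}^\epsilon_\delta u)\right|_h\ \ge\ C\,\|u\|_{L^2(\mathbb{R}^d)} ,$$ where $C$ is a positive constant that only depends on $\Omega$, $\delta_0$ and $M_0$.
   Context: Kernel. Let $d\ge1$ be an integer and let $\rho\ge0$ be a nonincreasing radial profile with $\rho(|s|)$ supported in the unit ball $B_1(0)\subset\mathbb{R}^d$ and $\int_{B_1(0)}\rho(|s|)|s|^2\,ds=2d$. For $\delta>0$ put $\rho_\delta(r)=\delta^{-(d+2)}\rho(r/\delta)$. Grid. Fix $\hat{\mathbf h}=(\hat h_1,\dots,\hat h_d)$ with positive entries and $\max_j\hat h_j=1$. For $h_{\max}>0$ let $\mathbf h=(h_1,\dots,h_d)=h_{\max}\hat{\mathbf h}$, $x_{\mathbf k}=(k_1h_1,\dots,k_dh_d)$ for $\mathbf k\in\mathbb{Z}^d$, and $\square=\{x_{\mathbf k}:\mathbf k\in\mathbb{Z}^d\}$. Window function: $\phi(t)=\frac23-4t^2+4t^3$ for $0\le t\le\frac12$, $\phi(t)=\frac43(1-t)^3$ for $\frac12\le t\le1$, $\phi(t)=0$ for $t>1$. Linear reproducing kernel (RK) basis: $\Psi_{\mathbf k}(x)=\prod_{j=1}^d\phi\!\left(\frac{|x_j-k_jh_j|}{2h_j}\right)$. For a sequence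 $(w_{\mathbf k})$, $|(w_{\mathbf k})|_h=\big\|\sum_{\mathbf k}w_{\mathbf k}\Psi_{\mathbf k}\big\|_{L^2(\mathbb{R}^d)}$, sequences defined on a subset of $\mathbb{Z}^d$ being first extended by zero. For a function $w$, $r^h_\Omega w=(w(x_{\mathbf k}))_{x_{\mathbf k}\in\square\cap\Omega}$. The trial space is $S(\square\cap\Omega)=\{\sum_{\mathbf k\in\mathbb{Z}^d}u_{\mathbf k}\Psi_{\mathbf k}: u_{\mathbf k}\in\mathbb{R},\ u_{\mathbf k}=0\text{ whenever }x_{\mathbf k}\notin\square\cap\Omega\}$. Quadrature points. $B^{\epsilon_1}_1(0)$ is a fixed finite set of points in the unit ball of $\mathbb{R}^d$, with $N_d\ge4d$ elements ($N_d$ depending only on $d$), invariant under changing the sign of any coordinate and under any permutation of coordinates; $\epsilon_1$ denotes the spacing of the points. With $\widetilde m_{\alpha}=\sum_{s\in B^{\epsilon_1}_1(0)}s^{\alpha}\rho(|s|)\phi(|s|)$ for multi-indices $\alpha$, the weights are $$\omega(s)=\frac{\phi(|s|)\,|s|^2}{\widetilde m_4}\ (d=1),\qquad \omega(s)=\frac{\phi(|s|)\,|s|^2}{(d-1)\widetilde m_{220\cdots0}+\widetilde m_{40\cdots0}}\ (d\ge2)$$ (a term with $s=0$, if any, is read as zero). Quasi-discrete operator. With $\epsilon=\delta\epsilon_1$, $B^\epsilon_\delta(0)=\{\delta s:s\in B^{\epsilon_1}_1(0)\}$ and $\omega_\delta(s)=\delta^d\omega(s/\delta)$, $$\mathcal{L}^\epsilon_\delta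 u(x)=2\sum_{s\in B^\epsilon_\delta(0)}\omega_\delta(s)\rho_\delta(|s|)\,(u(x+s)-u(x)).$$ The data $d,\rho,\hat{\mathbf h}$ and $B^{\epsilon_1}_1(0)$ are fixed throughout. *)

(* Defs.v *)
Set Warnings "-notation-overridden,-notation-incompatible-prefix".
From HB Require Import structures.
From mathcomp Require Import all_boot all_order perm all_algebra finmap.
From mathcomp Require Import all_classical all_reals all_analysis.

Set Implicit Arguments.
Unset Strict Implicit.
Unset Printing Implicit Defensive.
Import Order.TTheory GRing.Theory Num.Theory.
Import numFieldNormedType.Exports.

Local Open Scope classical_set_scope.
Local Open Scope ring_scope.

(* Lebesgue measure on R^n, carried by the product sigma-algebra of n.-tuple R:
   push-forward of lebesgue_measure \x (Lebesgue measure on R^n) under cons. *)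

Definition cons_pair (R : realType) (n : nat)
    (p : measurableTypeR R * n.-tuple (measurableTypeR R)) :
  n.+1.-tuple (measurableTypeR R) := [tuple of p.1 :: p.2].

Definition uncons_pair (R : realType) (n : nat)
    (t : n.+1.-tuple (measurableTypeR R)) :
  measurableTypeR R * n.-tuple (measurableTypeR R) :=
  (tnth t ord0, [tuple of behead t]).

Lemma measurable_cons_pair (R : realType) (n : nat) :
  measurable_fun [set: measurableTypeR R * n.-tuple (measurableTypeR R)]
    (@cons_pair R n).
Proof.
apply: measurable_cons; [exact: measurable_fst|exact: measurable_snd].
Qed.

Lemma measurable_uncons_pair (R : realType) (n : nat) :
  measurable_fun [set: n.+1.-tuple (measurableTypeR R)] (@uncons_pair R n).
Proof.
apply/measurable_fun_pairP; split; first exact: measurable_tnth.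
exact: measurable_behead.
Qed.

Lemma cons_pairK (R : realType) (n : nat) :
  cancel (@cons_pair R n) (@uncons_pair R n).
Proof. by move=> [x t]; congr pair; apply: val_inj. Qed.

Lemma uncons_pairK (R : realType) (n : nat) :
  cancel (@uncons_pair R n) (@cons_pair R n).
Proof. by move=> t; rewrite [RHS]tuple_eta; apply: val_inj. Qed.

Section cons_measure.
Context (R : realType) (n : nat).
Variable m : {sigma_finite_measure set (n.-tuple (measurableTypeR R)) -> \bar R}.

Definition cons_measure : set (n.+1.-tuple (measurableTypeR R)) -> \bar R :=
  pushforward (lebesgue_measure \x m)%E (@cons_pair R n).

Let cons_measure0 : cons_measure set0 = 0%E.
Proof. by rewrite /cons_measure /pushforward preimage_set0 measure0. Qed.

Let cons_measure_ge0 A : (0 <= cons_measure A)%E.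
Proof. by rewrite /cons_measure /pushforward measure_ge0. Qed.

Let cons_measure_sigma_additive : semi_sigma_additive cons_measure.
Proof.
move=> F mF tF mUF; rewrite /cons_measure /pushforward preimage_bigcup.
apply: measure_semi_sigma_additive.
- by move=> k; rewrite -[X in measurable X]setTI; exact: measurable_cons_pair.
- apply/trivIsetP => /= i j _ _ ij; rewrite -preimage_setI.
  by move/trivIsetP : tF => -> //; rewrite preimage_set0.
- rewrite -preimage_bigcup -[X in measurable X]setTI.
  exact: measurable_cons_pair.
Qed.

HB.instance Definition _ := isMeasure.Build _ _ _ cons_measure
  cons_measure0 cons_measure_ge0 cons_measure_sigma_additive.

Let cons_measure_sigma_finite : sigma_finite setT cons_measure.
Proof.
have /sigma_finiteP[F [TF ndF Foo]] := sigma_finiteT (@lebesgue_measure R).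
have /sigma_finiteP[G [TG ndG Goo]] := sigma_finiteT m.
exists (fun k => @uncons_pair R n @^-1` (F k `*` G k)).
  rewrite -preimage_bigcup (_ : \bigcup_k _ = setT) ?preimage_setT//.
  rewrite -subTset => -[x y] _.
  have [i _ Fix] : (\bigcup_k F k) x by rewrite -TF.
  have [j _ Gjy] : (\bigcup_k G k) y by rewrite -TG.
  exists (maxn i j) => //; split => /=.
    by move: x Fix; exact/subsetPset/ndF/leq_maxl.
  by move: y Gjy; exact/subsetPset/ndG/leq_maxr.
move=> k; have [mF Fk] := Foo k; have [mG Gk] := Goo k; split.
  rewrite -[X in measurable X]setTI; apply: measurable_uncons_pair => //.
  exact: measurableX.
rewrite /cons_measure /pushforward -comp_preimage.
rewrite (_ : _ \o _ = id) ?preimage_id; last first.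
  by apply/funext => p /=; rewrite cons_pairK.
by rewrite product_measure1E// lte_mul_pinfty// ge0_fin_numE.
Qed.

HB.instance Definition _ := Measure_isSigmaFinite.Build _ _ _ cons_measure
  cons_measure_sigma_finite.

End cons_measure.

Fixpoint lebesgueRn (R : realType) (n : nat) :
    {sigma_finite_measure set (n.-tuple (measurableTypeR R)) -> \bar R} :=
  match n with
  | 0 => \d_([tuple])
  | n'.+1 => cons_measure (lebesgueRn R n')
  end.

Definition point_of_tuple (R : realType) (n : nat)
  (t : n.-tuple (measurableTypeR R)) : 'rV[R]_n := \row_j tnth t j.

Definition integralRn (R : realType) (n : nat) (A : set 'rV[R]_n)
    (f : 'rV[R]_n -> R) : \bar R :=
  (\int[lebesgueRn R n]_(t in @point_of_tuple R n @^-1` A)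
     (f (point_of_tuple t))%:E)%E.

Definition L2norm (R : realType) (n : nat) (f : 'rV[R]_n -> R) : \bar R :=
  Lnorm (lebesgueRn R n) 2%:E (fun t => (f (point_of_tuple t))%:E).

(* The norm `|s| of the library on 'rV[R]_n is the sup norm. *)
Definition enorm (R : realType) (n : nat) (s : 'rV[R]_n) : R :=
  Num.sqrt (\sum_j s 0 j ^+ 2).

Definition unit_ball (R : realType) (n : nat) : set 'rV[R]_n :=
  [set s | enorm s <= 1].

(* rho is only constrained on r > 0, so that kernels that are singular at the
   origin are covered; rho 0 is immaterial in everything below. *)
Definition kernel_profile (R : realType) (d : nat) (rho : R -> R) : Prop :=
  [/\ forall r : R, 0 < r -> 0 <= rho r,
      forall r r' : R, 0 < r -> r <= r' -> rho r' <= rho r,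
      forall r : R, 1 < r -> rho r = 0 &
      integralRn (@unit_ball R d) (fun s => rho (enorm s) * enorm s ^+ 2)
        = (2 * d%:R)%:E].

Definition scaled_kernel (R : realType) (d : nat) (rho : R -> R) (delta r : R) :
  R := delta ^- d.+2 * rho (r / delta).

Definition grid_ratio (R : realType) (d : nat) (hhat : 'rV[R]_d) : Prop :=
  (forall j, 0 < hhat 0 j) /\ \big[Num.max/0]_j hhat 0 j = 1.

Definition grid_point (R : realType) (d : nat) (h : 'rV[R]_d) (k : 'rV[int]_d) :
  'rV[R]_d := \row_j ((k 0 j)%:~R * h 0 j).

Definition window (R : realType) (t : R) : R :=
  if t <= 1 / 2 then 2 / 3 - 4 * t ^+ 2 + 4 * t ^+ 3
  else if t <= 1 then 4 / 3 * (1 - t) ^+ 3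
  else 0.

Definition rk_basis (R : realType) (d : nat) (h : 'rV[R]_d) (k : 'rV[int]_d)
    (x : 'rV[R]_d) : R :=
  \prod_j window (`|x 0 j - (k 0 j)%:~R * h 0 j| / (2 * h 0 j)).

(* A \sum over [set: _] ranges over the indices with a nonzero term; at each x
   there are finitely many of them, as rk_basis h k has compact support. *)
Definition rk_sum (R : realType) (d : nat) (h : 'rV[R]_d)
    (w : 'rV[int]_d -> R) (x : 'rV[R]_d) : R :=
  \sum_(k \in [set: 'rV[int]_d]) w k * rk_basis h k x.

Definition seq_norm (R : realType) (d : nat) (h : 'rV[R]_d)
    (w : 'rV[int]_d -> R) : \bar R :=
  L2norm (rk_sum h w).

(* The restriction of w to the grid points in Omega, extended by zero. *)
Definition grid_restriction (R : realType) (d : nat) (h : 'rV[R]_d)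
    (Omega : set 'rV[R]_d) (w : 'rV[R]_d -> R) : 'rV[int]_d -> R :=
  (w \o grid_point h) \_ (grid_point h @^-1` Omega).

Definition trial_space (R : realType) (d : nat) (h : 'rV[R]_d)
    (Omega : set 'rV[R]_d) : set ('rV[R]_d -> R) :=
  [set u | exists2 c : 'rV[int]_d -> R,
     (forall k, ~ Omega (grid_point h k) -> c k = 0) & u = rk_sum h c].

Definition quadrature_points (R : realType) (d : nat) (B : {fset 'rV[R]_d}) :
    Prop :=
  [/\ forall s : 'rV[R]_d, s \in B -> unit_ball s,
      (4 * d <= #|` B|)%N,
      forall (s : 'rV[R]_d) (i : 'I_d), s \in B ->
        \row_j (if j == i then - s 0 j else s 0 j) \in B &
      forall (s : 'rV[R]_d) (p : 'S_d), s \in B -> col_perm p s \in B].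

(* The multi-index alpha is given by its list of entries, completed by zeros. *)
Definition moment (R : realType) (d : nat) (rho : R -> R) (B : {fset 'rV[R]_d})
    (alpha : seq nat) : R :=
  \sum_(s <- B) (\prod_(j < d) s 0 j ^+ nth 0%N alpha j)
                * rho (enorm s) * window (enorm s).

(* Positive unless rho (enorm s) * window (enorm s) = 0 at every s != 0 in B, in
   which case the weights are undefined; statements assume it is nonzero. *)
Definition weight_denominator (R : realType) (d : nat) (rho : R -> R)
    (B : {fset 'rV[R]_d}) : R :=
  if d == 1%N then moment rho B [:: 4%N]
  else d.-1%:R * moment rho B [:: 2%N; 2%N] + moment rho B [:: 4%N].

Definition weight (R : realType) (d : nat) (rho : R -> R) (B : {fset 'rV[R]_d})
    (s : 'rV[R]_d) : R :=
  window (enorm s) * enorm s ^+ 2 / weight_denominator rho B.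

Definition scaled_weight (R : realType) (d : nat) (rho : R -> R)
    (B : {fset 'rV[R]_d}) (delta : R) (s : 'rV[R]_d) : R :=
  delta ^+ d * weight rho B (delta^-1 *: s).

Definition scaled_points (R : realType) (d : nat) (B : {fset 'rV[R]_d})
    (delta : R) : {fset 'rV[R]_d} :=
  [fset delta *: s | s in B]%fset.

Definition quasi_discrete_op (R : realType) (d : nat) (rho : R -> R)
    (B : {fset 'rV[R]_d}) (delta : R) (u : 'rV[R]_d -> R) (x : 'rV[R]_d) : R :=
  2 * \sum_(s <- scaled_points B delta)
        scaled_weight rho B delta s * scaled_kernel d rho delta (enorm s)
        * (u (x + s) - u x).

(* Main.v *)
(* Write u = sum_k c_k Psi_k. The RK window is the cubic B-spline b, so at grid
   points u is a discrete convolution of c with Psi(y) = prod_j b(y_j), and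
     (-L u, c) = (2/delta^2) sum_s omega(s) rho(|s|) (A(0) - A(delta s / h)),
   where A(y) = sum_{k,l} c_k c_l Psi(k - l + y).

   As b is the autocorrelation of the hat function, Psi is a positive
   semidefinite kernel; hence A(y) <= A(0), every term of the sum is
   nonnegative, and A(0) - A(2 y) <= 4 (A(0) - A(y)). Fix one s <> 0 of positive
   weight and double y = delta s / h until the two copies of supp c no longer
   interact: then A(2^p y) = 0 and A(0) <= 4^p (A(0) - A(y)). Since Omega is
   bounded, 2^p delta stays bounded, and A(0) >= 3^-d |c|^2 because the symbol
   2/3 + cos(t)/3 of b on the integers is at least 1/3. This bounds (-L u, c), hence the
   l^2 norm of the restriction of -L u, from below by |c|.

   Finally the L^2 norm of sum_k w_k Psi_k is comparable to (prod_j h_j)^(1/2)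
   times the l^2 norm of w: in dimension one by diagonal dominance of b near the
   integers, in general by Tonelli's theorem, one coordinate at a time. *)
Require Import Defs.
Set Warnings "-notation-overridden,-notation-incompatible-prefix".
From HB Require Import structures.
From mathcomp Require Import all_boot all_order perm all_algebra finmap.
From mathcomp Require Import all_classical all_reals all_analysis.
From mathcomp Require Import measurable_realfun zify ring lra.

Set Implicit Arguments.
Unset Strict Implicit.
Unset Printing Implicit Defensive.
Import Order.TTheory GRing.Theory Num.Theory.
Import numFieldNormedType.Exports.

Local Open Scope classical_set_scope.
Local Open Scope ring_scope.

(** * Square-integral bounds for tensor products *)

Lemma sum_tuple_cons (V : zmodType) (I : finType) (n : nat) (F : n.+1.-tuple I -> V) :
  \sum_k F k = \sum_(k : n.-tuple I) \sum_i F [tuple of i :: k].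
Proof.
rewrite exchange_big pair_big/=.
rewrite (reindex (fun p : I * n.-tuple I => [tuple of p.1 :: p.2]))//=.
exists (fun t : n.+1.-tuple I => (thead t, [tuple of behead t])) => [[i k]|t] _ /=.
  by rewrite theadE; congr pair; apply: val_inj.
by rewrite [RHS]tuple_eta; apply: val_inj.
Qed.

Section tensor.
Context (R : realType) (I : finType).
Local Notation mR := (measurableTypeR R).

Definition tensor_sum (n : nat) (g : nat -> I -> mR -> R) (F : n.-tuple I -> R)
    (t : n.-tuple mR) : R :=
  \sum_k F k * \prod_(j < n) g j (tnth k j) (tnth t j).

Lemma measurable_tensor_sum n g F :
  (forall j i, measurable_fun setT (g j i)) ->
  measurable_fun setT (@tensor_sum n g F).
Proof.
move=> mg; apply: measurable_sum => k; apply: measurable_funM => //.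
apply: measurable_prod => j _; apply: measurableT_comp => //.
exact: measurable_tnth.
Qed.

Lemma tensor_sum_cons n (g : nat -> I -> mR -> R) (F : n.+1.-tuple I -> R) (x : mR)
    (t : n.-tuple mR) :
  tensor_sum g F (cons_pair (x, t)) =
  tensor_sum (fun j => g j.+1)
    (fun k => \sum_i F [tuple of i :: k] * g 0%N i x) t.
Proof.
rewrite /tensor_sum sum_tuple_cons; apply: eq_bigr => k _.
rewrite mulr_suml; apply: eq_bigr => i _.
rewrite big_ord_recl -mulrA; congr (_ * (_ * _)).
by apply: eq_bigr => j _; rewrite !tnthS.
Qed.
End tensor.

Section tensor_L2.
Context (R : realType) (I : finType).
Local Notation mR := (measurableTypeR R).

Lemma integral_lebesgueRn_cons n (f : n.+1.-tuple mR -> R) :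
  measurable_fun setT f -> (forall t, 0 <= f t) ->
  (\int[lebesgueRn R n.+1]_t (f t)%:E =
   \int[@lebesgue_measure R]_x \int[lebesgueRn R n]_t (f (cons_pair (x, t)))%:E)%E.
Proof.
move=> mf f0.
have mEf : measurable_fun setT (fun t => (f t)%:E) by exact/measurable_EFinP.
transitivity (\int[@lebesgue_measure R \x lebesgueRn R n]_p
    (f (cons_pair p))%:E)%E.
  exact: (ge0_integral_pushforward (@measurable_cons_pair R n)
    (@lebesgue_measure R \x lebesgueRn R n)%E measurableT mEf
    (fun t _ => (f0 t : (0 <= (f t)%:E)%E))).
apply: (@fubini_tonelli1 _ _ _ _ _ (@lebesgue_measure R) (lebesgueRn R n)
  (fun p => (f (cons_pair p))%:E)) => [|p]; last by rewrite lee_fin.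
by apply: measurableT_comp mEf (@measurable_cons_pair R n).
Qed.

(** Induction on the dimension by Tonelli: for a fixed first coordinate [x] the integrand is a
    tensor sum in the remaining variables with coefficients [F' x k], and each [F' x k] is in turn a
    one-dimensional sum in [x], to which the bounds for index 0 apply. *)
Lemma tensor_L2_bounds n (g : nat -> I -> mR -> R) (a b : nat -> R) :
  (forall j i, measurable_fun setT (g j i)) ->
  (forall j, 0 <= a j) -> (forall j, 0 <= b j) ->
  (forall j (f : I -> R),
    (((a j * \sum_i f i ^+ 2)%:E <=
      \int[@lebesgue_measure R]_x ((\sum_i f i * g j i x) ^+ 2)%:E)%E /\
    (\int[@lebesgue_measure R]_x ((\sum_i f i * g j i x) ^+ 2)%:E <=
      (b j * \sum_i f i ^+ 2)%:E)%E)) ->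
  forall F : n.-tuple I -> R,
    (((\prod_(j < n) a j) * \sum_k F k ^+ 2)%:E <=
      \int[lebesgueRn R n]_t ((tensor_sum g F t) ^+ 2)%:E)%E /\
    (\int[lebesgueRn R n]_t ((tensor_sum g F t) ^+ 2)%:E <=
      ((\prod_(j < n) b j) * \sum_k F k ^+ 2)%:E)%E.
Proof.
elim: n g a b => [|n IH] g a b mg a0 b0 ab F.
  have E (G : 0.-tuple I -> R) : \sum_k G k = G [tuple].
    rewrite (bigD1 [tuple])//= big1 ?addr0// => k.
    by rewrite tuple0 => /eqP.
  have int0 : (\int[lebesgueRn R 0]_t (tensor_sum g F t ^+ 2)%:E =
      (tensor_sum g F [tuple] ^+ 2)%:E)%E.
    etransitivity; first apply: integral_dirac => //.
      apply/measurable_EFinP; apply: measurable_funX.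
      exact: measurable_tensor_sum.
    by rewrite diracT mul1e.
  by rewrite int0 !big_ord0 !mul1r E /tensor_sum E big_ord0 mulr1.
have mts : measurable_fun setT (fun t => tensor_sum g F t ^+ 2).
  by apply: measurable_funX; exact: measurable_tensor_sum.
rewrite integral_lebesgueRn_cons//; last by move=> t; exact: sqr_ge0.
under eq_integral do under eq_integral do rewrite tensor_sum_cons.
have {}IH := IH (fun j => g j.+1) (fun j => a j.+1) (fun j => b j.+1)
  (fun j => mg j.+1) (fun j => a0 j.+1) (fun j => b0 j.+1) (fun j => ab j.+1).
set F' := fun x (k : n.-tuple I) => \sum_i F [tuple of i :: k] * g 0%N i x.
have mF' k : measurable_fun setT (fun x => F' x k).
  by apply: measurable_sum => i; apply: measurable_funM.
have int_scal c : 0 <= c ->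
    (\int[@lebesgue_measure R]_x (c * \sum_k F' x k ^+ 2)%:E =
     c%:E * \sum_k \int[@lebesgue_measure R]_x (F' x k ^+ 2)%:E)%E.
  move=> c0; under eq_integral do rewrite EFinM.
  rewrite ge0_integralZl_EFin//; last 2 first.
  - by move=> x _; rewrite lee_fin sumr_ge0// => k _; exact: sqr_ge0.
  - apply/measurable_EFinP; apply: measurable_sum => k.
    exact: measurable_funX.
  congr (_ * _)%E; under eq_integral do rewrite -sumEFin.
  rewrite ge0_integral_sum// => [k|k x _]; last by rewrite lee_fin sqr_ge0.
  by apply/measurable_EFinP; exact: measurable_funX.
have mS c : measurable_fun setT (fun x => (c * \sum_k F' x k ^+ 2)%:E).
  apply/measurable_EFinP; apply: measurable_funM => //.
  by apply: measurable_sum => k; exact: measurable_funX.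
have mI : measurable_fun setT (fun x => \int[lebesgueRn R n]_t
   (tensor_sum (fun j => g j.+1) (F' x) t ^+ 2)%:E)%E.
  pose f p := (tensor_sum g F (cons_pair p) ^+ 2)%:E.
  rewrite (_ : (fun x => _) = fubini_F (lebesgueRn R n) f); last first.
    by apply/funext => x; apply: eq_integral => t _; rewrite /f tensor_sum_cons.
  have mf : measurable_fun setT f.
    have mEf : measurable_fun setT (fun t => (tensor_sum g F t ^+ 2)%:E).
      exact/measurable_EFinP.
    by apply: measurableT_comp mEf (@measurable_cons_pair R n).
  have f0 p : (0 <= f p)%E by rewrite lee_fin sqr_ge0.
  exact: (@measurable_fun_fubini_tonelli_F _ _ _ _ _ (lebesgueRn R n) f mf f0).
have a'0 : 0 <= \prod_(j < n) a j.+1 by apply: prodr_ge0.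
have b'0 : 0 <= \prod_(j < n) b j.+1 by apply: prodr_ge0.
rewrite !big_ord_recl !sum_tuple_cons; split.
- apply: (@le_trans _ _ (\int[@lebesgue_measure R]_x
      ((\prod_(j < n) a j.+1) * \sum_k F' x k ^+ 2)%:E)%E); last first.
    apply: ge0_le_integral => //= x _; last exact: (IH (F' x)).1.
    by rewrite lee_fin mulr_ge0// sumr_ge0// => k _; exact: sqr_ge0.
  rewrite int_scal// -mulrA mulrCA mulr_sumr EFinM -sumEFin.
  rewrite lee_wpmul2l ?lee_fin//; apply: lee_sum => k _.
  by exact: (ab 0%N (fun i => F [tuple of i :: k])).1.
- apply: (@le_trans _ _ (\int[@lebesgue_measure R]_x
      ((\prod_(j < n) b j.+1) * \sum_k F' x k ^+ 2)%:E)%E).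
    apply: ge0_le_integral => //= x _; last exact: (IH (F' x)).2.
    by apply: integral_ge0 => t _; rewrite lee_fin sqr_ge0.
  rewrite int_scal// -mulrA mulrCA mulr_sumr EFinM -sumEFin.
  rewrite lee_wpmul2l ?lee_fin//; apply: lee_sum => k _.
  by exact: (ab 0%N (fun i => F [tuple of i :: k])).2.
Qed.
End tensor_L2.

(** * Positive semidefinite kernels *)

Section psd.
Context (R : realType).

Definition psd (I : finType) (L : I -> I -> R) : Prop :=
  forall c : I -> R, 0 <= \sum_i \sum_j c i * c j * L i j.

(** A Schur product whose second factor is given as a Gram kernel: each [v] contributes the form of
    [L] at the coefficients [c i * g v i]. *)
Lemma psdM_gram (I V : finType) (L : I -> I -> R) (w : R) (g : V -> I -> R) :
  psd L -> 0 <= w ->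
  psd (fun i j => w * (\sum_v g v i * g v j) * L i j).
Proof.
move=> pL w0 c.
have -> : \sum_i \sum_j c i * c j * (w * (\sum_v g v i * g v j) * L i j) =
    w * \sum_v \sum_i \sum_j (c i * g v i) * (c j * g v j) * L i j.
  rewrite mulr_sumr; under [RHS]eq_bigr do rewrite mulr_sumr.
  rewrite [RHS]exchange_big; apply: eq_bigr => i _ /=.
  under [RHS]eq_bigr do rewrite mulr_sumr.
  rewrite [RHS]exchange_big; apply: eq_bigr => j _ /=.
  rewrite mulr_sumr mulr_suml mulr_sumr; apply: eq_bigr => v _.
  ring.
by apply: mulr_ge0 => //; apply: sumr_ge0 => v _; exact: pL.
Qed.

Lemma psdD (I : finType) (L M : I -> I -> R) :
  psd L -> psd M -> psd (fun i j => L i j + M i j).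
Proof.
move=> pL pM c; rewrite (eq_bigr (fun i => \sum_j c i * c j * L i j + \sum_j c i * c j * M i j)).
  by rewrite big_split addr_ge0.
by move=> i _; rewrite -big_split; apply: eq_bigr => j _; rewrite mulrDr.
Qed.

Lemma eq_psd (I : finType) (L M : I -> I -> R) :
  (forall i j, L i j = M i j) -> psd L -> psd M.
Proof.
move=> LM pL c; rewrite (eq_bigr (fun i => \sum_j c i * c j * L i j)) //.
by move=> i _; apply: eq_bigr => j _; rewrite LM.
Qed.

Lemma psd1 (I : finType) : psd (fun _ _ : I => 1).
Proof.
move=> c; rewrite (_ : \sum_i _ = (\sum_i c i) ^+ 2) ?sqr_ge0//.
by rewrite expr2 big_distrlr; apply: eq_bigr => i _; apply: eq_bigr => j _; rewrite mulr1.
Qed.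

(** The coefficients on [J] are summed over the fibres of [p]. *)
Lemma psd_comp (I J : finType) (p : J -> I) (L : I -> I -> R) :
  psd L -> psd (fun i j => L (p i) (p j)).
Proof.
move=> pL c; have := pL (fun i => \sum_(j | p j == i) c j).
have pull (F : I -> R) : \sum_i (\sum_(j | p j == i) c j) * F i = \sum_j c j * F (p j).
  rewrite [RHS](partition_big p xpredT)//=; apply: eq_bigr => i _.
  by rewrite mulr_suml; apply: eq_bigr => j /eqP <-.
congr (_ <= _); under eq_bigr do under eq_bigr do rewrite -mulrA.
under eq_bigr do rewrite -mulr_sumr pull.
rewrite pull; apply: eq_bigr => j _.
by rewrite mulr_sumr; apply: eq_bigr => k _; rewrite mulrA.
Qed.

(* [trunc_int A x y] is the integral of [(x - z)_+ (y - z)_+] over [0, A], for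
   nonnegative arguments. *)
Definition trunc_int (A x y : R) : R :=
  let m := Num.min A (Num.min x y) in
  x * y * m - (x + y) * m ^+ 2 / 2 + m ^+ 3 / 3.

Definition pospart (x : R) : R := Num.max x 0.

Lemma trunc_intC A x y : trunc_int A x y = trunc_int A y x.
Proof. by rewrite /trunc_int minC [Num.min x y]minC minC; ring. Qed.

(** On [[A, A + h]] the integrand differs from its value at [A] by at most [(x + y) * h]. This
    estimate stands in for differentiating the integral in its upper limit. *)
Lemma trunc_int_incr A h x y : 0 <= x -> 0 <= y -> 0 <= A -> 0 <= h ->
  `|trunc_int (A + h) x y - trunc_int A x y - h * (pospart (x - A) * pospart (y - A))|
  <= (x + y) * h ^+ 2.
Proof.
wlog xy : x y / x <= y.
  move=> W x0 y0 A0 h0; have [|/ltW] := leP x y => xy; first exact: W.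
  by rewrite (trunc_intC (A + h)) (trunc_intC A x) (mulrC (pospart (x - A))) (addrC x y); exact: W.
move=> x0 y0 A0 h0; rewrite /trunc_int /= (min_l xy).
have hh : 0 <= h ^+ 2 by exact: sqr_ge0.
have [xA|Ax] := leP x A.
  have xAh : x <= A + h by lra.
  rewrite (min_r xAh) {1}/pospart max_r ?subr_le0//.
  rewrite subrr mul0r mulr0 subr0 normr0; apply: mulr_ge0 => //; lra.
rewrite /pospart max_l ?subr_ge0 ?(ltW Ax)// max_l ?subr_ge0; last lra.
have [xAh|Axh] := leP x (A + h).
  rewrite ler_norml.
  have [u [u0 Eu]] : exists u, 0 <= u /\ x = A + u by exists (x - A); split; lra.
  have uh : u <= h by lra.
  have u2 : u ^+ 2 <= h ^+ 2 by rewrite lerXn2r.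
  have uuh : u * h <= h ^+ 2 by nra.
  have [v [v0 Ev]] : exists v, 0 <= v /\ y = x + v by exists (y - x); split; lra.
  subst y; subst x.
  (* Nonnegative products of the gaps; given these, both cubic inequalities are linear
     consequences. *)
  have Ah : 0 <= A * h ^+ 2 by rewrite mulr_ge0.
  have t1 : 0 <= u * h ^+ 2 by rewrite mulr_ge0.
  have t2 : 0 <= v * h ^+ 2 by rewrite mulr_ge0.
  have t3 : 0 <= u ^+ 3 by rewrite exprn_ge0.
  have t4 : 0 <= v * u ^+ 2 by rewrite mulr_ge0// exprn_ge0.
  have t5 : 0 <= u ^+ 2 * (h - u) by rewrite mulr_ge0 ?exprn_ge0// subr_ge0.
  have t6 : 0 <= u * v * (h - u) by rewrite mulr_ge0 ?subr_ge0// mulr_ge0.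
  have t7 : 0 <= u * (h ^+ 2 - u * h) by rewrite mulr_ge0 ?subr_ge0.
  have t8 : 0 <= v * (h ^+ 2 - u * h) by rewrite mulr_ge0 ?subr_ge0.
  apply/andP; split; lra.
have [u [u0 Eu]] : exists u, 0 <= u /\ x = A + h + u by exists (x - A - h); split; lra.
have [v [v0 Ev]] : exists v, 0 <= v /\ y = x + v by exists (y - x); split; lra.
rewrite ler_norml; subst y; subst x.
have h3 : 0 <= h ^+ 3 by rewrite exprn_ge0.
have Ah : 0 <= A * h ^+ 2 by rewrite mulr_ge0.
have t1 : 0 <= u * h ^+ 2 by rewrite mulr_ge0.
have t2 : 0 <= v * h ^+ 2 by rewrite mulr_ge0.
apply/andP; split; lra.
Qed.
End psd.

(** * The cubic B-spline kernel *)

Section spline.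
Context (R : realType).

Definition bspline (y : R) : R := window (`|y| / 2).

Lemma window_pos (t : R) : 0 <= t ->
  window t = (4 * pospart (1 - t) ^+ 3 - 16 * pospart (1 / 2 - t) ^+ 3) / 3.
Proof.
move=> t0; rewrite /window /pospart; case: ifPn => [th|].
  by rewrite !max_l ?subr_ge0//; [field|lra].
rewrite -ltNge => th; rewrite [Num.max (1 / 2 - t) 0]max_r; last by lra.
case: ifPn => [t1|]; first by rewrite max_l ?subr_ge0//; field.
by rewrite -ltNge => t1; rewrite max_r; [field|lra].
Qed.

Lemma bsplineN y : bspline (- y) = bspline y.
Proof. by rewrite /bspline normrN. Qed.

Lemma bspline_eq0 y : 2 <= `|y| -> bspline y = 0.
Proof.
move=> y2; rewrite /bspline window_pos; last by rewrite mulr_ge0.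
rewrite /pospart (max_r (_ : 1 - _ <= 0)); last lra.
by rewrite (max_r (_ : 1 / 2 - _ <= 0)); [field|lra].
Qed.

Definition diff2 (b : 'I_3) : R := if val b == 1%N then -2 else 1.

(* The convolution identity of B-splines: pairing the two hat functions centred
   at [x] and [y], which are second differences of [fun x => pospart (x - z)]. *)
Lemma bspline_trunc_int A x y : 1 <= x -> 1 <= y -> x + 1 <= A -> y + 1 <= A ->
  bspline (x - y) = \sum_(a < 3) \sum_(b < 3) diff2 a * diff2 b *
    trunc_int A (x + a%:R - 1) (y + b%:R - 1).
Proof.
wlog xy : x y / x <= y.
  move=> W x1 y1 xA yA; have [|/ltW] := leP x y => xy; first exact: W.
  rewrite -bsplineN opprB W// exchange_big; apply: eq_bigr => a _.
  by apply: eq_bigr => b _; rewrite trunc_intC [diff2 a * _]mulrC.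
move=> x1 y1 xA yA.
(* The integration stops at the smaller argument, so [trunc_int] is a polynomial as soon as the
   order of its arguments is known. *)
have T s t : s <= A -> s <= t -> trunc_int A s t = s ^+ 2 * t / 2 - s ^+ 3 / 6.
  by move=> sA st; rewrite /trunc_int/= (min_l st) min_r//; field.
have T' s t : t <= A -> t <= s -> trunc_int A s t = t ^+ 2 * s / 2 - t ^+ 3 / 6.
  by move=> *; rewrite trunc_intC T.
rewrite !big_ord_recl !big_ord0 /diff2 /= /bump/= ?addn0 ?add0n ?add1n !addr0.
rewrite /bspline ler0_norm ?subr_le0// window_pos; last lra.
rewrite /pospart.
(* The order of the two triples of nodes, and the set of vanishing truncated powers, change only
   when [y - x] crosses 1 and 2. *)
have [d1|d1] := leP (y - x) 1; last have [d2|d2] := leP (y - x) 2.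
- rewrite (max_l (_ : 0 <= 1 - _)); last lra.
  rewrite (max_l (_ : 0 <= 1 / 2 - _)); last lra.
  rewrite (T (x - 1) (y - 1)); [|lra|lra].
  rewrite (T (x - 1) (y + 1 - 1)); [|lra|lra].
  rewrite (T (x - 1) (y + 2 - 1)); [|lra|lra].
  rewrite (T' (x + 1 - 1) (y - 1)); [|lra|lra].
  rewrite (T (x + 1 - 1) (y + 1 - 1)); [|lra|lra].
  rewrite (T (x + 1 - 1) (y + 2 - 1)); [|lra|lra].
  rewrite (T' (x + 2 - 1) (y - 1)); [|lra|lra].
  rewrite (T' (x + 2 - 1) (y + 1 - 1)); [|lra|lra].
  rewrite (T (x + 2 - 1) (y + 2 - 1)); [|lra|lra].
  by field.
- rewrite (max_l (_ : 0 <= 1 - _)); last lra.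
  rewrite (max_r (_ : 1 / 2 - _ <= 0)); last lra.
  rewrite (T (x - 1) (y - 1)); [|lra|lra].
  rewrite (T (x - 1) (y + 1 - 1)); [|lra|lra].
  rewrite (T (x - 1) (y + 2 - 1)); [|lra|lra].
  rewrite (T (x + 1 - 1) (y - 1)); [|lra|lra].
  rewrite (T (x + 1 - 1) (y + 1 - 1)); [|lra|lra].
  rewrite (T (x + 1 - 1) (y + 2 - 1)); [|lra|lra].
  rewrite (T' (x + 2 - 1) (y - 1)); [|lra|lra].
  rewrite (T (x + 2 - 1) (y + 1 - 1)); [|lra|lra].
  rewrite (T (x + 2 - 1) (y + 2 - 1)); [|lra|lra].
  by field.
- rewrite (max_r (_ : 1 - _ <= 0)); last lra.
  rewrite (max_r (_ : 1 / 2 - _ <= 0)); last lra.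
  do 9 (rewrite T; [|lra|lra]).
  by field.
Qed.

(** The form [F B] vanishes at [B = 0], and a step of length [h] adds [h] times a value of the form
    of [L], up to an error [E * h ^+ 2]. With [n] steps of length [A / n] the total error is
    [E * A ^+ 2 / n], which tends to 0. *)
Lemma psdM_trunc_int (I : finType) (L : I -> I -> R) (x : I -> R) (A : R) :
  psd L -> 0 <= A -> (forall i, 0 <= x i) ->
  psd (fun i j => L i j * trunc_int A (x i) (x j)).
Proof.
move=> pL A0 x0 c.
pose F B := \sum_i \sum_j c i * c j * (L i j * trunc_int B (x i) (x j)).
pose E := \sum_i \sum_j `|c i * c j * L i j| * (x i + x j).
have E0 : 0 <= E.
  by apply: sumr_ge0 => i _; apply: sumr_ge0 => j _; rewrite mulr_ge0// addr_ge0.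
have step B h : 0 <= B -> 0 <= h -> F B - E * h ^+ 2 <= F (B + h).
  move=> B0 h0.
  have P := pL (fun i => c i * pospart (x i - B)).
  have D : F B + h * (\sum_i \sum_j c i * pospart (x i - B) * (c j * pospart (x j - B)) * L i j)
      - E * h ^+ 2 <= F (B + h).
    rewrite /F /E mulr_sumr mulr_suml -big_split -sumrB.
    apply: ler_sum => i _; rewrite mulr_sumr mulr_suml -big_split -sumrB.
    apply: ler_sum => j _ /=.
    have := trunc_int_incr (x0 i) (x0 j) B0 h0.
    set t1 := trunc_int _ _ _; set t2 := trunc_int _ _ _.
    set q1 := pospart _; set q2 := pospart _; set w := c i * c j * L i j => H.
    have : - (`|w| * ((x i + x j) * h ^+ 2)) <= w * (t1 - t2 - h * (q1 * q2)).
      have := ler_norml (w * (t1 - t2 - h * (q1 * q2))) (`|w| * ((x i + x j) * h ^+ 2)).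
      by rewrite normrM ler_wpM2l// => /esym /andP[].
    rewrite /w; lra.
  apply: le_trans D; rewrite lerD2r lerDl mulr_ge0//.
have steps B h n : 0 <= B -> 0 <= h -> F B - E * h ^+ 2 * n%:R <= F (B + h * n%:R).
  move=> B0 h0; elim: n => [|n IH]; first by rewrite !mulr0 subr0 addr0.
  have := step (B + h * n%:R) h (addr_ge0 B0 (mulr_ge0 h0 (ler0n _ _))) h0.
  by rewrite -natr1 !mulrDr !mulr1 addrA; lra.
have F0 : F 0 = 0.
  rewrite /F big1// => i _; rewrite big1// => j _.
  by rewrite /trunc_int/= min_l ?le_min ?x0//; field.
rewrite leNgt; apply/negP => FA.
have {}FA : F A < 0 by [].
(* Enough steps for the total error to be smaller than [- F A]. *)
pose n := (Num.truncn (E * A ^+ 2 / - F A)).+1.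
have n0 : 0 < n%:R :> R by rewrite ltr0n.
have := steps 0 (A / n%:R) n (lexx _) (divr_ge0 A0 (ltW n0)).
rewrite F0 add0r divfK ?gt_eqF// add0r leNgt => /negP; apply.
have -> : E * (A / n%:R) ^+ 2 * n%:R = E * A ^+ 2 / n%:R by field; rewrite gt_eqF.
rewrite ltrNr ltr_pdivrMr// (mulrC (- F A)) -ltr_pdivrMr ?oppr_gt0//.
exact: truncnS_gt.
Qed.

(** The B-spline is an integral of products of hat functions, and these are second differences of
    truncated linear functions. The factor [L] is carried along so that products over coordinates
    follow by iteration. *)
Lemma psdM_bspline (I : finType) (L : I -> I -> R) (x : I -> R) :
  psd L -> psd (fun i j => L i j * bspline (x i - x j)).
Proof.
move=> pL c.
(* Only differences of nodes matter, so all are shifted by [s]; the hat functions centred at the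
   shifted nodes then live inside [[0, A]]. *)
pose s := 1 + \sum_i `|x i|.
have xs i : `|x i| <= \sum_i `|x i|.
  by rewrite (bigD1 i)//= lerDl sumr_ge0.
have s1 i : 1 <= x i + s.
  by rewrite /s; have := xs i; have := ler_norm (- x i); rewrite normrN; lra.
pose A := 2 * s + 1.
have xA i : x i + s + 1 <= A.
  by rewrite /A /s; have := xs i; have := ler_norm (x i); lra.
have A0 : 0 <= A by rewrite /A /s; have : 0 <= \sum_i `|x i| by [apply: sumr_ge0]; lra.
(* Each node is replaced by the three nodes of its second difference, with weights [diff2]. *)
pose p (u : I * 'I_3) := x u.1 + s + u.2%:R - 1.
have p0 u : 0 <= p u.
  by rewrite /p; have := s1 u.1; have : 0 <= u.2%:R :> R by []; lra.
have := psdM_trunc_int (psd_comp (fun u : I * 'I_3 => u.1) pL) A0 p0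
  (fun u => c u.1 * diff2 u.2).
congr (_ <= _).
rewrite -(pair_big xpredT xpredT (fun i a => \sum_j (c i * diff2 a) * (c j.1 * diff2 j.2)
  * (L i j.1 * trunc_int A (p (i, a)) (p j))))/=.
apply: eq_bigr => i _.
under eq_bigr => a _ do rewrite -(pair_big xpredT xpredT (fun j b =>
  (c i * diff2 a) * (c j * diff2 b) * (L i j * trunc_int A (p (i, a)) (p (j, b)))))/=.
rewrite exchange_big; apply: eq_bigr => j _ /=.
have -> : x i - x j = (x i + s) - (x j + s) by ring.
rewrite (bspline_trunc_int (s1 i) (s1 j) (xA i) (xA j)) !mulr_sumr.
apply: eq_bigr => a _; rewrite !mulr_sumr; apply: eq_bigr => b _.
by rewrite /p/=; ring.
Qed.

Lemma psd_prod_bspline (I : finType) (T : Type) (s : seq T) (x : I -> T -> R) :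
  psd (fun i j => \prod_(l <- s) bspline (x i l - x j l)).
Proof.
elim: s => [|l s IH].
  by apply: eq_psd (@psd1 R I) => i j; rewrite big_nil.
apply: eq_psd (psdM_bspline (x ^~ l) IH) => i j.
by rewrite big_cons mulrC.
Qed.
End spline.

(** * The B-spline kernel at integer points *)

Section integer_points.
Context (R : realType).

Lemma sum_eq_indicator n (a b : nat) : (a < n)%N ->
  \sum_(v < n) (a == v)%:R * (b == v)%:R = (a == b)%:R :> R.
Proof.
move=> an; rewrite (bigD1 (Ordinal an))//= eqxx mul1r big1 ?addr0 1?eq_sym// => v va.
rewrite (_ : (a == v) = false) ?mul0r//; apply/negbTE; apply: contra va => /eqP av.
by apply/eqP/val_inj.
Qed.

(** The values 2/3 at 0 and 1/6 at distance 1, arranged as a third of the identity plus a sixth of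
    the Gram kernel of the sets [{a, a + 1}]. *)
Lemma bspline_nat a b : bspline (a%:R - b%:R : R) = (a == b)%:R / 3 +
  ((a == b)%:R + (a == b.+1)%:R + (a.+1 == b)%:R + (a.+1 == b.+1)%:R) / 6.
Proof.
wlog ab : a b / (a <= b)%N.
  move=> W; have [|/ltnW] := leqP a b => ab; first exact: W.
  by rewrite -bsplineN opprB W// ![b == _]eq_sym ![b.+1 == _]eq_sym; ring.
rewrite -(subnK ab) natrD opprD addrCA subrr addr0 bsplineN.
rewrite eqSS [(a == _.+1)]ltn_eqF ?ltnS ?leq_addl// -[X in X == _]add0n -[a.+1]add1n !eqn_add2r.
case: (b - a)%N => [|[|n]] /=.
- rewrite /bspline normr0 mul0r window_pos// /pospart !max_l; [|lra|lra].
  by field.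
- rewrite /bspline normr1 window_pos; last lra.
  rewrite /pospart (max_l (_ : 0 <= 1 - _)); last lra.
  by rewrite max_l; [field|lra].
- by rewrite bspline_eq0 ?normr_nat ?ler_nat//=; lra.
Qed.

Lemma psdM_eq (I V : finType) (L : I -> I -> R) (p : I -> V) :
  psd L -> psd (fun i j => (p i == p j)%:R * L i j).
Proof.
move=> pL; apply: eq_psd (psdM_gram (fun v i => (p i == v)%:R) pL ler01) => i j.
rewrite mul1r (bigD1 (p i))//= eqxx mul1r big1 ?addr0 1?eq_sym// => v.
by rewrite eq_sym => /negbTE ->; rewrite mul0r.
Qed.

(* On the integers the B-spline minus a third of the identity is the Gram
   kernel of the indicators of pairs of consecutive integers. *)
Lemma psdM_bspline_sub_eq (I : finType) m (L : I -> I -> R) (p : I -> 'I_m) :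
  psd L ->
  psd (fun i j => (bspline ((p i)%:R - (p j)%:R) - (p i == p j)%:R / 3) * L i j).
Proof.
move=> pL.
have w0 : 0 <= 6^-1 :> R by lra.
apply: eq_psd (psdM_gram (V := 'I_m.+1)
  (fun v i => (val (p i) == v)%:R + ((p i).+1 == v)%:R) pL w0) => i j.
congr (_ * _); rewrite bspline_nat.
under eq_bigr do rewrite mulrDl !mulrDr.
have h i' : ((p i') < m.+1)%N by rewrite ltnS ltnW.
have h' i' : ((p i').+1 < m.+1)%N by rewrite ltnS.
rewrite !big_split/= !sum_eq_indicator//.
rewrite (_ : (p i == p j) = (val (p i) == val (p j)))//.
by field.
Qed.

(** With [X] the product over the tail and [e] its product of indicators, one more coordinate splits
    as [(b - eq / 3) * X + eq / 3 * (X - 3^-n * e)], both parts being positive semidefinite. *)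
Lemma psd_prod_bspline_sub_eq (I : finType) (T : Type) m (s : seq T)
    (p : I -> T -> 'I_m) :
  psd (fun i j => \prod_(l <- s) bspline ((p i l)%:R - (p j l)%:R)
    - 3^-1 ^+ size s * \prod_(l <- s) (p i l == p j l)%:R : R).
Proof.
elim: s => [|l s IH].
  apply: eq_psd (_ : psd (fun _ _ => 0)) => [i j|c]; first by rewrite !big_nil; ring.
  by rewrite big1// => i _; rewrite big1// => j _; rewrite mulr0.
have pX : psd (fun i j : I => \prod_(l <- s) bspline ((p i l)%:R - (p j l)%:R) : R).
  exact: (psd_prod_bspline s (fun i l => (p i l)%:R)).
have P1 := psdM_bspline_sub_eq (p ^~ l) pX.
(* The one-element Gram kernel of the constant 1 only supplies the factor 1/3. *)
have P2 := psdM_gram (V := unit) (fun _ _ => 1)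
  (psdM_eq (p ^~ l) IH) (_ : 0 <= 3^-1).
apply: eq_psd (psdD P1 (P2 _)) => [i j|]; last lra.
by rewrite !big_cons big_const card_unit /= exprS; ring.
Qed.
End integer_points.

(** * The autocorrelation of the coefficients and its behaviour under doubling *)

Section autocorrelation.
Context (R : realType) (I T : finType) (c : I -> R) (x : I -> T -> R).

(** The function [A(y)] of the opening outline, with real nodes [x i] and [y] in units of the mesh
    width. *)
Definition autocorr (y : T -> R) : R :=
  \sum_i \sum_j c i * c j * \prod_l bspline (x i l - x j l + y l).

Lemma autocorrN y : autocorr (fun l => - y l) = autocorr y.
Proof.
rewrite /autocorr exchange_big; apply: eq_bigr => i _; apply: eq_bigr => j _.
rewrite [c j * _]mulrC; congr (_ * _); apply: eq_bigr => l _.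
by rewrite -bsplineN; congr bspline; ring.
Qed.

Lemma eq_autocorr y y' : y =1 y' -> autocorr y = autocorr y'.
Proof. by move=> /funext ->. Qed.

(** Positive semidefiniteness of the spline kernel at the points [x i + a * y], [a = 0, 1, 2], with
    coefficients [w a * c i]: the Toeplitz matrix of [A(0)], [A(y)], [A(2y)] inherits it. *)
Lemma autocorr_psd (w : 'I_3 -> R) y :
  0 <= \sum_a \sum_b w a * w b * autocorr (fun l => (a%:R - b%:R) * y l).
Proof.
have := psd_prod_bspline (enum T) (fun (u : 'I_3 * I) l => x u.2 l + u.1%:R * y l)
  (fun u => w u.1 * c u.2).
congr (_ <= _).
rewrite -(pair_big xpredT xpredT (fun a i => \sum_(v : 'I_3 * I)
  w a * c i * (w v.1 * c v.2) *
  \prod_(l <- enum T) bspline (x i l + a%:R * y l - (x v.2 l + v.1%:R * y l))))/=.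
apply: eq_bigr => a _.
under eq_bigr => i _ do rewrite -(pair_big xpredT xpredT (fun b j => w a * c i * (w b * c j) *
  \prod_(l <- enum T) bspline (x i l + a%:R * y l - (x j l + b%:R * y l))))/=.
rewrite exchange_big; apply: eq_bigr => b _ /=.
rewrite /autocorr mulr_sumr; apply: eq_bigr => i _.
rewrite mulr_sumr; apply: eq_bigr => j _.
rewrite [in RHS]mulrA; congr (_ * _); first by ring.
rewrite big_enum; apply: eq_bigr => l _; congr bspline; ring.
Qed.

Let sum3 (w : 'I_3 -> R) (y : T -> R) a0 a1 a2 :
  autocorr (fun=> 0) = a0 -> autocorr y = a1 ->
  autocorr (fun l => 2 * y l) = a2 ->
  \sum_a \sum_b w a * w b * autocorr (fun l => (a%:R - b%:R) * y l) =
  (w 0 ^+ 2 + w 1 ^+ 2 + w 2%:R ^+ 2) * a0 +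
  2 * (w 0 * w 1 + w 1 * w 2%:R) * a1 + 2 * w 0 * w 2%:R * a2.
Proof.
move=> e0 e1 e2.
have F0 (a : R) : autocorr (fun l => (a - a) * y l) = a0.
  by rewrite -e0; apply: eq_autocorr => l; ring.
have F1 (a b : R) : b = a + 1 -> autocorr (fun l => (b - a) * y l) = a1.
  by move=> ->; rewrite -e1; apply: eq_autocorr => l; ring.
have F1' (a b : R) : b = a + 1 -> autocorr (fun l => (a - b) * y l) = a1.
  by move=> /F1 <-; rewrite -autocorrN; apply: eq_autocorr => l; ring.
have F2 : autocorr (fun l => (2 - 0) * y l) = a2.
  by rewrite -e2; apply: eq_autocorr => l; ring.
have F2' : autocorr (fun l => (0 - 2) * y l) = a2.
  by rewrite -e2 -autocorrN; apply: eq_autocorr => l; ring.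
rewrite !big_ord_recl !big_ord0 /=.
have -> : lift ord0 ord0 = 1 :> 'I_3 by apply: val_inj.
have -> : lift ord0 (lift ord0 ord0) = 2%:R :> 'I_3 by apply: val_inj.
have -> : ord0 = 0 :> 'I_3 by apply: val_inj.
rewrite /bump /= ?addn0 ?add1n.
rewrite !F0 (F1 0 1) ?(F1' 0 1) ?(F1 1 2) ?(F1' 1 2) ?F2 ?F2'; [ring|ring..].
Qed.

(** The Toeplitz form at the weights 1, -1, 0. *)
Lemma autocorr_le0 y : autocorr y <= autocorr (fun=> 0).
Proof.
have := autocorr_psd (fun a => (a == 0)%:R - (a == 1)%:R) y.
rewrite (sum3 _ erefl erefl erefl) /=; lra.
Qed.

(** The Toeplitz form at the weights 1, -2, 1 equals [6 A(0) - 8 A(y) + 2 A(2y)]. *)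
Lemma autocorr_double y :
  autocorr (fun=> 0) - autocorr (fun l => 2 * y l) <=
  4 * (autocorr (fun=> 0) - autocorr y).
Proof.
have := autocorr_psd (fun a => if a == 1 then -2 else 1) y.
rewrite (sum3 _ erefl erefl erefl) /=; lra.
Qed.

Lemma autocorr_dyadic y n :
  autocorr (fun=> 0) - autocorr (fun l => 2 ^+ n * y l) <=
  4 ^+ n * (autocorr (fun=> 0) - autocorr y).
Proof.
elim: n => [|n IH].
  by rewrite !expr0 mul1r (@eq_autocorr (fun l => 1 * y l) y)// => l; rewrite mul1r.
have := autocorr_double (fun l => 2 ^+ n * y l).
rewrite (@eq_autocorr (fun l => 2 * _) (fun l => 2 ^+ n.+1 * y l)); last first.
  by move=> l; rewrite exprS mulrA.
move=> /le_trans; apply; rewrite exprS -mulrA; lra.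
Qed.
End autocorrelation.

(** * Stability of integer translates of the cubic B-spline *)

Section spline_L2.
Context (R : realType).
Local Notation mR := (measurableTypeR R).

Lemma bspline_pos (y : R) :
  bspline y = (pospart (2 - `|y|) ^+ 3 - 4 * pospart (1 - `|y|) ^+ 3) / 6.
Proof.
have posM (a b : R) : 0 <= a -> pospart (a * b) = a * pospart b.
  by move=> a0; rewrite /pospart maxr_pMr// mulr0.
rewrite /bspline window_pos ?divr_ge0//.
have -> : 1 - `|y| / 2 = 2^-1 * (2 - `|y|) by field.
have -> : 1 / 2 - `|y| / 2 = 2^-1 * (1 - `|y|) by field.
rewrite !posM; [by field|lra|lra].
Qed.

Lemma bspline_ge0 (y : R) : 0 <= bspline y.
Proof.
have y0 := normr_ge0 y; rewrite /bspline /window.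
case: ifPn => [t|_]; last case: ifPn => // t; last first.
  by rewrite mulr_ge0// exprn_ge0// subr_ge0.
have t0 : 0 <= `|y| / 2 by lra.
move: t t0; set t := `|y| / 2 => t12 t0.
have : t ^+ 2 <= 1 / 4 by nra.
have : 0 <= t ^+ 2 * (1 / 2 - t) by apply: mulr_ge0; [exact: sqr_ge0|lra].
have : 0 <= t ^+ 3 by rewrite exprn_ge0.
nra.
Qed.

Lemma bspline_le1 (y : R) : bspline y <= 1.
Proof.
have y0 := normr_ge0 y; rewrite /bspline /window.
have t0 : 0 <= `|y| / 2 by lra.
move: t0; set t := `|y| / 2 => t0.
case: ifPn => [t1|t1]; last case: ifPn => // t2.
- have : 0 <= t ^+ 2 * (1 - t) by apply: mulr_ge0; [exact: sqr_ge0|lra].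
  nra.
- have : (1 - t) ^+ 3 <= (1 / 2) ^+ 3.
    by rewrite lerXn2r// ?nnegrE; lra.
  lra.
Qed.

(** This bound and the next two serve within 1/10 of a node: there the node's own spline dominates
    those of the first neighbours, at distance at least 9/10, and of the second, at distance at
    least 19/10. *)
Lemma bspline_center (y : R) : `|y| <= 1 / 10 -> 13 / 20 <= bspline y.
Proof.
move=> y1; have y0 := normr_ge0 y; rewrite bspline_pos /pospart !max_l; [|lra|lra].
have : `|y| ^+ 2 <= 1 / 100 by nra.
have : 0 <= `|y| ^+ 3 by rewrite exprn_ge0.
nra.
Qed.

Lemma bspline_side (y : R) : 9 / 10 <= `|y| -> bspline y <= 6 / 25.
Proof.
move=> y1; rewrite bspline_pos.
have [y2|y2] := leP 2 `|y|.
  rewrite /pospart max_r ?subr_le0// max_r; last lra.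
  by rewrite !expr0n /=; lra.
rewrite /pospart max_l; last lra.
have p3 : 0 <= Num.max (1 - `|y|) 0 ^+ 3 by rewrite exprn_ge0// le_max lexx orbT.
have [y3|y3] := leP 1 `|y|.
  have : (2 - `|y|) ^+ 3 <= 1 ^+ 3 by rewrite lerXn2r ?nnegrE; lra.
  lra.
rewrite max_l; last lra.
have [u [u0 u1 ->]] : exists u, [/\ 0 <= u, u <= 1 / 10 & `|y| = 1 - u].
  by exists (1 - `|y|); split; lra.
have : u ^+ 2 <= 1 / 100 by nra.
have : 0 <= u ^+ 3 by rewrite exprn_ge0.
nra.
Qed.

Lemma bspline_tail (y : R) : 19 / 10 <= `|y| -> bspline y <= 1 / 100.
Proof.
move=> y1; rewrite bspline_pos.
rewrite /pospart [X in 4 * X ^+ 3]max_r; last lra.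
have [y2|y2] := leP 2 `|y|.
  by rewrite max_r ?subr_le0// !expr0n /=; lra.
rewrite max_l; last lra.
have : (2 - `|y|) ^+ 3 <= (1 / 10) ^+ 3 by rewrite lerXn2r ?nnegrE; lra.
rewrite !expr0n /=; lra.
Qed.

Lemma measurable_bspline : measurable_fun setT (@bspline R : mR -> R).
Proof.
have mpos (a : R) : measurable_fun setT (fun y : mR => pospart (a - `|y|) ^+ 3).
  apply: measurable_funX; apply: measurable_maxr => //.
  apply: measurable_funB => //; exact: normr_measurable.
rewrite (_ : @bspline R = fun y : mR =>
    (pospart (2 - `|y|) ^+ 3 - 4 * pospart (1 - `|y|) ^+ 3) * 6^-1); last first.
  by apply/funext => y; exact: bspline_pos.
by apply: measurable_funM => //; apply: measurable_funB => //; apply: measurable_funM.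
Qed.

(** Each term is at most 1, and only the integers from [floor t - 1] to [floor t + 2] can lie in the
    support. *)
Lemma sum_bspline_le4 m (t : R) : \sum_(i < m) bspline (t - i%:R) <= 4.
Proof.
have pt (i : 'I_m) : bspline (t - i%:R) <=
    \sum_(e < 4) (i%:Z == Num.floor t + e%:Z - 1)%:R.
  have [t2|t2] := leP 2 `|t - i%:R|.
    by rewrite bspline_eq0// sumr_ge0.
  move: t2; rewrite ltr_norml => /andP[t2 t3].
  have f1 := floor_le_tmp t; have f2 := floorD1_gt t.
  have : (Num.floor t)%:~R < (i%:Z + 2)%:~R :> R.
    by rewrite intrD; apply: le_lt_trans f1 _; rewrite -ltrBlDr; lra.
  have : (i%:Z - 2)%:~R < (Num.floor t + 1)%:~R :> R.
    by rewrite intrB; apply: lt_trans f2; lra.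
  rewrite !ltr_int => g1 g2.
  apply: le_trans (bspline_le1 _) _.
  have [e [e4 ->]] : exists e, (e < 4)%N /\ i%:Z = Num.floor t + e%:Z - 1.
    by exists (absz (i%:Z - Num.floor t + 1)); split; lia.
  rewrite (bigD1 (Ordinal e4))//= eqxx lerDl sumr_ge0//.
apply: le_trans (ler_sum _ (fun i _ => pt i)) _.
rewrite exchange_big /=; apply: (@le_trans _ _ (\sum_(e < 4) 1)); last first.
  by rewrite sumr_const card_ord.
apply: ler_sum => e _.
case: (pselect (exists i : 'I_m, i%:Z = Num.floor t + e%:Z - 1)) => [[i Ei]|N].
  rewrite (bigD1 i)//= Ei eqxx big1 ?addr0// => j ji.
  rewrite (_ : _ == _ = false)//; apply/negbTE; apply: contra ji => /eqP Ej.
  apply/eqP/val_inj; have := Ej; rewrite -Ei => -[]//.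
rewrite big1 ?ler01// => i _; rewrite (_ : _ == _ = false)//.
by apply/negbTE/negP => /eqP Ei; apply: N; exists i.
Qed.

(** Weighted Cauchy-Schwarz, from summing [(f i - f j) ^+ 2 * (g i * g j) >= 0] over all pairs. *)
Lemma sqr_sum_le (I : finType) (f g : I -> R) : (forall i, 0 <= g i) ->
  (\sum_i f i * g i) ^+ 2 <= (\sum_i g i) * \sum_i f i ^+ 2 * g i.
Proof.
move=> g0; set A := _ ^+ 2; set B := _ * _.
have EA : A = \sum_i \sum_j f i * f j * (g i * g j).
  by rewrite /A expr2 big_distrlr; apply: eq_bigr => i _; apply: eq_bigr => j _ /=; ring.
have EB : B = \sum_i \sum_j f j ^+ 2 * (g i * g j).
  by rewrite /B big_distrlr; apply: eq_bigr => i _; apply: eq_bigr => j _ /=; ring.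
have EB' : B = \sum_i \sum_j f i ^+ 2 * (g i * g j).
  by rewrite EB exchange_big; apply: eq_bigr => i _; apply: eq_bigr => j _ /=; ring.
suff : 2 * A <= B + B by lra.
rewrite {1}EB EB' EA mulr_sumr -big_split; apply: ler_sum => i _ /=.
rewrite mulr_sumr -big_split; apply: ler_sum => j _ /=.
have : 0 <= (f i - f j) ^+ 2 * (g i * g j) by rewrite mulr_ge0 ?sqr_ge0 ?mulr_ge0.
lra.
Qed.

(** * Two-sided square-integral bounds in dimension one *)

Section L2_bounds.
Variables (m : nat) (h z : R) (f : 'I_m -> R).
Hypothesis h0 : 0 < h.

Definition spline_sum (x : mR) : R := \sum_i f i * bspline (x / h + z - i%:R).

Lemma measurable_bspline_shift (a : R) :
  measurable_fun setT (fun x : mR => bspline (x / h + z - a)).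
Proof.
apply: measurableT_comp measurable_bspline _.
by apply: measurable_funB => //; apply: measurable_funD => //; apply: measurable_funM.
Qed.

Lemma measurable_spline_sum : measurable_fun setT spline_sum.
Proof.
apply: measurable_sum => i; apply: measurable_funM => //.
exact: measurable_bspline_shift.
Qed.

Definition knot_itv (r : R) (i : 'I_m) : set mR :=
  [set` `[h * (i%:R - z - r), h * (i%:R - z + r)]].

Lemma knot_itvE r i x : knot_itv r i x = (`|x / h + z - i%:R| <= r) :> Prop.
Proof.
have -> : x / h + z - i%:R = (x - h * (i%:R - z)) / h by field; rewrite gt_eqF.
rewrite /knot_itv /= in_itv /= normrM (gtr0_norm (_ : 0 < h^-1)) ?invr_gt0//.
rewrite ler_pdivrMr// ler_norml; congr is_true.
apply/andP/andP => -[? ?]; split; lra.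
Qed.

Lemma measurable_knot_itv r i : measurable (knot_itv r i).
Proof. exact: measurable_itv. Qed.

Lemma integral_knot_itv r (e : 'I_m -> R) : 0 < r -> (forall i, 0 <= e i) ->
  (\int[@lebesgue_measure R]_x (\sum_i e i * \1_(knot_itv r i) x)%:E =
   (2 * r * h * \sum_i e i)%:E)%E.
Proof.
move=> r0 e0.
under eq_integral do rewrite -sumEFin.
rewrite ge0_integral_sum//=; last 2 first.
- move=> i; apply/measurable_EFinP; apply: measurable_funM => //.
  apply: measurable_indic; exact: measurable_knot_itv.
- by move=> i x _; rewrite lee_fin mulr_ge0.
rewrite mulr_sumr -sumEFin; apply: eq_bigr => i _.
under eq_integral do rewrite EFinM.
rewrite ge0_integralZl_EFin//=; last first.
  apply/measurable_EFinP; apply: measurable_indic; exact: measurable_knot_itv.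
rewrite integral_indic//; last exact: measurable_knot_itv.
rewrite setIT; have := lebesgue_measure_itv `[h * (i%:R - z - r), h * (i%:R - z + r)].
rewrite -/(knot_itv r i) => /= ->; rewrite lte_fin ltr_pM2l// ifT; last lra.
by rewrite -EFinB -EFinM; congr EFin; ring.
Qed.

(** Cauchy-Schwarz with the splines as weights costs a factor 4. Each spline is then replaced by the
    indicator of its support, of length [4 * h]. *)
Lemma spline_sum_L2_le :
  (\int[@lebesgue_measure R]_x (spline_sum x ^+ 2)%:E <=
   (16 * h * \sum_i f i ^+ 2)%:E)%E.
Proof.
have -> : 16 * h * \sum_i f i ^+ 2 = 2 * 2 * h * \sum_i (4 * f i ^+ 2).
  by rewrite -mulr_sumr; ring.
rewrite -integral_knot_itv//; last by move=> i; rewrite mulr_ge0// sqr_ge0.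
apply: ge0_le_integral => //.
- by move=> x _; rewrite lee_fin sqr_ge0.
- by apply/measurable_EFinP; apply: measurable_funX; exact: measurable_spline_sum.
- apply/measurable_EFinP; apply: measurable_sum => i; apply: measurable_funM => //.
  apply: measurable_indic; exact: measurable_knot_itv.
move=> x _; rewrite lee_fin.
apply: le_trans (sqr_sum_le _ (fun i => bspline_ge0 _)) _.
apply: le_trans (ler_wpM2r _ (sum_bspline_le4 m (x / h + z))) _.
  by apply: sumr_ge0 => i _; rewrite mulr_ge0 ?sqr_ge0 ?bspline_ge0.
rewrite mulr_sumr; apply: ler_sum => i _; rewrite mulrA.
apply: ler_wpM2l; first by rewrite mulr_ge0 ?sqr_ge0.
rewrite indicE; case: (asboolP (knot_itv 2 i x)) => [K|K].
  by rewrite mem_set//= bspline_le1.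
rewrite bspline_eq0 ?mulr_ge0 ?mul0r ?indic_ge0//.
by rewrite leNgt; apply/negP => x2; apply: K; rewrite knot_itvE ltW.
Qed.

(* Off-diagonal bounds for the values of the basis functions within 1/10 of a
   node; their row sums are at most 1/2, less than the diagonal value 13/20. *)
Let w (i k : nat) : R :=
  6 / 25 * ((k == i.+1)%:R + (i == k.+1)%:R) +
  1 / 100 * ((k == i.+2)%:R + (i == k.+2)%:R).

Let w_ge0 i k : 0 <= w i k.
Proof. by rewrite /w addr_ge0// mulr_ge0// ?addr_ge0//; lra. Qed.

Let sum_w_le (i : 'I_m) : \sum_(k < m) w i k <= 1 / 2.
Proof.
have le1 (P : pred 'I_m) : (forall k l, P k -> P l -> k = l) -> \sum_k (P k)%:R <= 1 :> R.
  move=> Pu; case: (pickP P) => [k Pk|N]; last by rewrite big1 ?ler01// => k _; rewrite N.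
  rewrite (bigD1 k)//= Pk big1 ?addr0// => l lk.
  by case Pl: (P l) => //; case/eqP: lk; exact: Pu.
rewrite big_split -!mulr_sumr !big_split/=.
have a1 := le1 (fun k => val k == i.+1); have a2 := le1 (fun k => val i == k.+1).
have a3 := le1 (fun k => val k == i.+2); have a4 := le1 (fun k => val i == k.+2).
have {}a1 := a1 (fun k l => ltac:(move=> /= /eqP kE /eqP lE; apply: val_inj => /=; lia)).
have {}a2 := a2 (fun k l => ltac:(move=> /= /eqP kE /eqP lE; apply: val_inj => /=; lia)).
have {}a3 := a3 (fun k l => ltac:(move=> /= /eqP kE /eqP lE; apply: val_inj => /=; lia)).
have {}a4 := a4 (fun k l => ltac:(move=> /= /eqP kE /eqP lE; apply: val_inj => /=; lia)).
lra.
Qed.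

(** For [U] the value of the spline sum, [U ^+ 2 >= 2 * t * (f i * U) - t ^+ 2 * f i ^+ 2], with
    [f i * U] bounded below through [w]. Summed over [i], that bound keeps the surplus
    [13/20 - 1/2 = 3/20], and [t = 3/20] is the best choice. *)
Let lower (i : 'I_m) : R :=
  2 * (3 / 20) * (13 / 20 * f i ^+ 2 - \sum_(k < m) w i k * (f i ^+ 2 + f k ^+ 2) / 2)
  - (3 / 20) ^+ 2 * f i ^+ 2.

Let sum_lower : 9 / 400 * \sum_i f i ^+ 2 <= \sum_i lower i.
Proof.
have : \sum_(i < m) \sum_(k < m) w i k * (f i ^+ 2 + f k ^+ 2) / 2 <= 1 / 2 * \sum_i f i ^+ 2.
  (* As [w] is symmetric, the average of [f i ^+ 2] and [f k ^+ 2] may be replaced by [f i ^+ 2],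
     which leaves the row sums. *)
  have -> : \sum_(i < m) \sum_(k < m) w i k * (f i ^+ 2 + f k ^+ 2) / 2 =
      \sum_(i < m) \sum_(k < m) w i k * f i ^+ 2.
    transitivity (\sum_(i < m) \sum_(k < m) (w i k * f i ^+ 2 / 2 + w k i * f k ^+ 2 / 2)).
      apply: eq_bigr => i _; apply: eq_bigr => k _.
      by rewrite (_ : w k i = w i k); [ring|rewrite /w; ring].
    under eq_bigr do rewrite big_split.
    rewrite big_split/= [X in _ + X]exchange_big/= -big_split; apply: eq_bigr => i _.
    by rewrite -big_split; apply: eq_bigr => k _ /=; field.
  rewrite mulr_sumr; apply: ler_sum => i _; rewrite -mulr_suml.
  by apply: ler_wpM2r; [exact: sqr_ge0|exact: sum_w_le].
rewrite /lower sumrB -!mulr_sumr sumrB -mulr_sumr; lra.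
Qed.

Let bspline_le_w (x : mR) (i k : 'I_m) : `|x / h + z - i%:R| <= 1 / 10 -> k != i ->
  bspline (x / h + z - k%:R) <= w i k.
Proof.
move=> xi ki; set t := x / h + z in xi *.
have w0 := w_ge0 i k.
have far (n : nat) : (n <= `|i - k|)%N -> n%:R - 1 / 10 <= `|t - k%:R|.
  move=> n1.
  have E : t - k%:R = (i%:R - k%:R) + (t - i%:R) by ring.
  rewrite E; apply: le_trans (lerB_normD _ _).
  apply: lerB => //.
  have : (n%:R : R) <= (`|i%:Z - k%:Z|%N)%:R by rewrite ler_nat.
  by move=> /le_trans; apply; rewrite natr_absz intr_norm intrB.
have ne : nat_of_ord k <> i by move=> /val_inj /eqP; rewrite (negbTE ki).
have [d3|d3] := leqP 3 `|i - k|%N.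
  rewrite bspline_eq0//; have := far _ d3; lra.
have [d2|d2] := leqP 2 `|i - k|%N.
  apply: le_trans (bspline_tail _) _; first by have := far _ d2; lra.
  have : (k == i.+2 :> nat) || (i == k.+2 :> nat) by lia.
  rewrite /w; case/orP => ->;
  by do 3 (case: (_ == _)); rewrite /=; lra.
have d1 : (1 <= `|i - k|)%N by lia.
apply: le_trans (bspline_side _) _; first by have := far _ d1; lra.
have : (k == i.+1 :> nat) || (i == k.+1 :> nat) by lia.
rewrite /w; case/orP => ->;
by do 3 (case: (_ == _)); rewrite /=; lra.
Qed.

Let lower_le (x : mR) (i : 'I_m) : `|x / h + z - i%:R| <= 1 / 10 ->
  lower i <= spline_sum x ^+ 2.
Proof.
move=> xi; set U := spline_sum x.
have fU : 13 / 20 * f i ^+ 2 - \sum_(k < m) w i k * (f i ^+ 2 + f k ^+ 2) / 2 <= f i * U.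
  rewrite /U /spline_sum (bigD1 i)//= mulrDr.
  rewrite [\sum_(k < m) _](bigD1 i)//=.
  have wi : 0 <= w i i * (f i ^+ 2 + f i ^+ 2) / 2.
    by rewrite divr_ge0 ?mulr_ge0 ?w_ge0// addr_ge0 ?sqr_ge0.
  have diag : 13 / 20 * f i ^+ 2 <= f i * (f i * bspline (x / h + z - i%:R)).
    have := ler_wpM2r (sqr_ge0 (f i)) (bspline_center xi); lra.
  have off : - \sum_(k < m | k != i) w i k * (f i ^+ 2 + f k ^+ 2) / 2 <=
      f i * \sum_(k < m | k != i) f k * bspline (x / h + z - k%:R).
    rewrite -sumrN mulr_sumr; apply: ler_sum => k ki.
    have b0 := bspline_ge0 (x / h + z - k%:R).
    have bw := bspline_le_w xi ki.
    have s0 : 0 <= f i ^+ 2 + f k ^+ 2 by rewrite addr_ge0 ?sqr_ge0.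
    have := ler_wpM2r s0 bw.
    have : 0 <= (f i + f k) ^+ 2 * bspline (x / h + z - k%:R).
      by rewrite mulr_ge0 ?sqr_ge0.
    lra.
  lra.
have := sqr_ge0 (U - 3 / 20 * f i); rewrite /lower; lra.
Qed.

(** The intervals of radius 1/10 about the nodes are disjoint, and on the [i]-th one the integrand
    is at least [lower i]. Cutting [lower] off at 0 makes the step function nonnegative; its
    integral gives [2 / 10 * 9 / 400 = 9 / 2000]. *)
Lemma spline_sum_L2_ge :
  ((9 / 2000 * h * \sum_i f i ^+ 2)%:E <=
   \int[@lebesgue_measure R]_x (spline_sum x ^+ 2)%:E)%E.
Proof.
pose e i := Num.max (lower i) 0.
have e0 i : 0 <= e i by rewrite le_max lexx orbT.
apply: (@le_trans _ _ (2 * (1 / 10) * h * \sum_i e i)%:E).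
  rewrite lee_fin.
  have : \sum_i lower i <= \sum_i e i by apply: ler_sum => i _; rewrite le_max lexx.
  have := sum_lower; set S := \sum_i f i ^+ 2 => s1 s2.
  have : 9 / 400 * S <= \sum_i e i by lra.
  by move=> /(ler_wpM2l (ltW h0)); lra.
have r0 : 0 < 1 / 10 :> R by lra.
rewrite -integral_knot_itv//.
apply: ge0_le_integral => //.
- by move=> x _; rewrite lee_fin sumr_ge0// => i _; rewrite mulr_ge0.
- apply/measurable_EFinP; apply: measurable_sum => i; apply: measurable_funM => //.
  apply: measurable_indic; exact: measurable_knot_itv.
- by apply/measurable_EFinP; apply: measurable_funX; exact: measurable_spline_sum.
move=> x _; rewrite lee_fin.
case: (pselect (exists i, knot_itv (1 / 10) i x)) => [[i ix]|N]; last first.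
  rewrite big1 ?sqr_ge0// => i _; rewrite indicE.
  by rewrite memNset ?mulr0//= => ix; apply: N; exists i.
move: (ix); rewrite knot_itvE => xi.
rewrite (bigD1 i)//= indicE mem_set//= mulr1 big1 ?addr0 => [|k ki].
  by rewrite /e ge_max sqr_ge0 andbT; exact: lower_le.
rewrite indicE memNset ?mulr0// => kx.
have : `|x / h + z - k%:R| <= 1 / 10 by rewrite -knot_itvE.
move: xi; rewrite !ler_norml => /andP[xi1 xi2] /andP[xk1 xk2].
have : i%:R < (k.+1)%:R :> R by rewrite -natr1; lra.
have : k%:R < (i.+1)%:R :> R by rewrite -natr1; lra.
rewrite !ltr_nat !ltnS => k1 k2; case/eqP: ki; apply: val_inj.
by apply/eqP; rewrite eqn_leq k1 k2.
Qed.
End L2_bounds.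
End spline_L2.

(** * Quadrature weights *)

Section quadrature.
Context (R : realType) (d : nat) (rho : R -> R) (B : {fset 'rV[R]_d}).
Hypotheses (d_gt0 : (0 < d)%N) (rho_ge0 : forall r : R, 0 < r -> 0 <= rho r).

Lemma window_ge0 (t : R) : 0 <= t -> 0 <= window t.
Proof.
move=> t0; have := bspline_ge0 (t * 2).
by rewrite /bspline ger0_norm ?mulr_ge0// mulfK ?pnatr_eq0.
Qed.

Lemma enorm_ge0 (s : 'rV[R]_d) : 0 <= enorm s.
Proof. exact: sqrtr_ge0. Qed.

Lemma enorm0 : enorm (0 : 'rV[R]_d) = 0.
Proof. by rewrite /enorm big1 ?sqrtr0// => j _; rewrite mxE expr0n. Qed.

Lemma enorm_gt0 (s : 'rV[R]_d) : s != 0 -> 0 < enorm s.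
Proof.
case/rV0Pn => j sj; rewrite /enorm sqrtr_gt0 (bigD1 j)//=.
apply: ltr_wpDr; first by apply: sumr_ge0 => k _; exact: sqr_ge0.
by rewrite lt_def sqr_ge0 sqrf_eq0 sj.
Qed.

Lemma enormZ (a : R) (s : 'rV[R]_d) : 0 <= a -> enorm (a *: s) = a * enorm s.
Proof.
move=> a0; rewrite /enorm -[X in X * _](ger0_norm a0) -sqrtr_sqr -sqrtrM ?sqr_ge0//.
by congr Num.sqrt; rewrite mulr_sumr; apply: eq_bigr => j _; rewrite mxE exprMn.
Qed.

Section moment.
Variable alpha : seq nat.
Hypotheses (alpha_even : all (fun n => ~~ odd n) alpha) (alpha0 : (0 < nth 0 alpha 0)%N).

Let term (s : 'rV[R]_d) : R :=
  (\prod_(j < d) s 0 j ^+ nth 0%N alpha j) * rho (enorm s) * window (enorm s).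

(** The first coordinate enters with a positive power, which removes the unspecified value
    [rho 0]. *)
Let term0 : term 0 = 0.
Proof.
rewrite /term (bigD1 (Ordinal d_gt0))//= mxE expr0n (gtn_eqF alpha0).
by rewrite !mul0r.
Qed.

Let term_ge0 s : 0 <= term s.
Proof.
have [->|s0] := eqVneq s 0; first by rewrite term0.
rewrite !mulr_ge0 ?rho_ge0 ?enorm_gt0 ?window_ge0 ?enorm_ge0//.
apply: prodr_ge0 => j _; apply: exprn_even_ge0.
have [ja|ja] := ltnP j (size alpha); last by rewrite nth_default.
exact: (allP alpha_even) (mem_nth _ ja).
Qed.

Lemma moment_ge0 : 0 <= moment rho B alpha.
Proof. by rewrite /moment; apply: sumr_ge0 => s _; exact: term_ge0. Qed.

Lemma moment_neq0 : moment rho B alpha != 0 ->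
  exists s, [/\ s \in B, s != 0, 0 < rho (enorm s) & 0 < window (enorm s)].
Proof.
move=> m0; apply: contrapT => N; case/eqP: m0; rewrite /moment.
rewrite big_seq big1// => s sB; rewrite -/(term s).
have [->|s0] := eqVneq s 0; first exact: term0.
apply/eqP; apply: contrapT => /negP; rewrite /term !mulf_eq0 !negb_or -andbA.
move=> /and3P[_ r0 w0]; apply: N; exists s; split=> //.
  by rewrite lt_def r0 rho_ge0 ?enorm_gt0.
by rewrite lt_def w0 window_ge0 ?enorm_ge0.
Qed.
End moment.

Lemma weight_denominator_ge0 : 0 <= weight_denominator rho B.
Proof.
by rewrite /weight_denominator; case: ifP => _;
  rewrite ?addr_ge0 ?mulr_ge0 ?moment_ge0.
Qed.

Lemma weight_denominator_neq0 : weight_denominator rho B != 0 ->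
  exists s, [/\ s \in B, s != 0, 0 < rho (enorm s) & 0 < window (enorm s)].
Proof.
rewrite /weight_denominator; case: ifP => _; first exact: moment_neq0.
have [->|m _] := eqVneq (moment rho B [:: 2%N; 2%N]) 0; last exact: moment_neq0 m.
by rewrite mulr0 add0r; exact: moment_neq0.
Qed.

Hypothesis den_neq0 : weight_denominator rho B != 0.

Lemma weight_rho_ge0 (s : 'rV[R]_d) : 0 <= weight rho B s * rho (enorm s).
Proof.
have [->|s0] := eqVneq s 0; first by rewrite /weight enorm0 expr0n mulr0 !mul0r.
rewrite mulr_ge0 ?rho_ge0 ?enorm_gt0// /weight divr_ge0 ?weight_denominator_ge0//.
by rewrite mulr_ge0 ?sqr_ge0 ?window_ge0 ?enorm_ge0.
Qed.

Lemma weight_rho_gt0 :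
  exists s, [/\ s \in B, s != 0 & 0 < weight rho B s * rho (enorm s)].
Proof.
have [s [sB s0 r0 w0]] := weight_denominator_neq0 den_neq0.
exists s; split=> //; rewrite mulr_gt0// /weight divr_gt0//.
  by rewrite mulr_gt0// exprn_gt0// enorm_gt0.
by rewrite lt_def den_neq0 weight_denominator_ge0.
Qed.

(** The scalings of weight and kernel combine to [delta ^- 2], and the sum runs over the unscaled
    points. *)
Lemma quasi_discrete_opE (delta : R) (u : 'rV[R]_d -> R) x : 0 < delta ->
  quasi_discrete_op rho B delta u x = 2 / delta ^+ 2 *
    \sum_(s <- B) weight rho B s * rho (enorm s) * (u (x + delta *: s) - u x).
Proof.
move=> d0; have dn0 : delta != 0 by rewrite gt_eqF.
rewrite /quasi_discrete_op -mulrA; congr (2 * _).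
rewrite big_imfset/=; last by move=> s t _ _; exact: scalerI.
rewrite mulr_sumr; apply: eq_bigr => s _.
rewrite /scaled_weight /scaled_kernel scalerA mulVf// scale1r enormZ ?ltW//.
have -> : delta ^- 2 = delta ^+ d * delta ^- d.+2.
  rewrite -[d.+2]addn2 exprD; have := expf_neq0 d dn0.
  by set p := delta ^+ d => p0; field; rewrite dn0.
rewrite [delta * enorm s]mulrC mulfK//.
by set q := delta ^- _; set p := delta ^+ d; ring.
Qed.
End quadrature.

(** * Finitely supported coefficients *)

Section box.
Context (R : realType) (d N : nat).
Local Notation J := (d.-tuple 'I_(N.*2.+1)).

(** The cube of multi-indices with entries from [-N] to [N], encoded by a finite type through a
    shift by [N]. *)
Definition box_index (k : J) : 'rV[int]_d := \row_j ((tnth k j)%:Z - N%:Z).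

Lemma box_index_inj : injective box_index.
Proof.
move=> k l /rowP kl; apply: eq_from_tnth => j; apply: val_inj.
by have := kl j; rewrite !mxE => /addIr [].
Qed.

Lemma box_index_surj (q : 'rV[int]_d) :
  (forall j, (`|(q 0 j)%R| <= N)%N) -> exists k, box_index k = q.
Proof.
move=> qN; exists [tuple inord (absz (q 0 j + N%:Z)) | j < d].
apply/rowP => j; rewrite mxE tnth_mktuple inordK; have := qN j; lia.
Qed.

Variable h : 'rV[R]_d.
Hypothesis h0 : forall j, 0 < h 0 j.

Lemma rk_basis_box k (x : 'rV[R]_d) :
  rk_basis h (box_index k) x =
  \prod_j bspline (x 0 j / h 0 j + N%:R - (tnth k j)%:R).
Proof.
apply: eq_bigr => j _; rewrite mxE /bspline; congr window.
have hj : h 0 j != 0 by rewrite gt_eqF.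
rewrite intrB.
have -> : x 0 j - ((tnth k j)%:R - N%:R) * h 0 j =
    h 0 j * (x 0 j / h 0 j + N%:R - (tnth k j)%:R) by field.
rewrite normrM (gtr0_norm (h0 j)); by field.
Qed.

Variable c : 'rV[int]_d -> R.
Hypothesis c0 : forall q, (forall k, box_index k <> q) -> c q = 0.

Lemma rk_sum_box (x : 'rV[R]_d) :
  rk_sum h c x = \sum_(k : J) c (box_index k) * rk_basis h (box_index k) x.
Proof.
rewrite /rk_sum -(fsbig_widen [set` [seq box_index k | k <- enum {: J}]])//=; last first.
  move=> q [_ qN]; rewrite /= c0 ?mul0r// => k kq; apply: qN.
  by rewrite /= -kq map_f// mem_enum.
rewrite -fsbig_seq; first by rewrite big_map big_enum.
by rewrite map_inj_uniq ?enum_uniq//; exact: box_index_inj.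
Qed.

(** The tensor bounds take families indexed by all naturals; the default 1 keeps the mesh widths
    positive beyond [d]. *)
Let hn (j : nat) : R := if insub j is Some j' then h 0 j' else 1.

Let hnE (j : 'I_d) : hn j = h 0 j.
Proof. by rewrite /hn valK. Qed.

Let hn_gt0 j : 0 < hn j.
Proof. by rewrite /hn; case: insub => [j'|]. Qed.

(** [Q] is the squared norm, a real number because the upper tensor bound is finite. *)
Lemma L2norm_rk_sum : exists Q : R,
  [/\ L2norm (rk_sum h c) = (Num.sqrt Q)%:E,
    (9 / 2000) ^+ d * (\prod_j h 0 j) * (\sum_k c (box_index k) ^+ 2) <= Q &
    Q <= 16 ^+ d * (\prod_j h 0 j) * (\sum_k c (box_index k) ^+ 2)].
Proof.
pose g (j : nat) (i : 'I_(N.*2.+1)) (x : measurableTypeR R) : R :=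
  bspline (x / hn j + N%:R - i%:R).
pose F (k : J) := c (box_index k).
have mg j i : measurable_fun setT (g j i) by exact: measurable_bspline_shift.
have a0 j : 0 <= 9 / 2000 * hn j by have := hn_gt0 j; lra.
have b0 j : 0 <= 16 * hn j by have := hn_gt0 j; lra.
have [lo hi] := tensor_L2_bounds mg a0 b0 (fun j f =>
  conj (spline_sum_L2_ge N%:R f (hn_gt0 j)) (spline_sum_L2_le N%:R f (hn_gt0 j))) F.
have prodE (e : R) : \prod_(j < d) (e * hn j) = e ^+ d * \prod_j h 0 j.
  by rewrite big_split/= prodr_const card_ord; congr (_ * _); apply: eq_bigr => j _.
rewrite !prodE in lo hi.
set A := (\int[_]_t _)%E in lo hi.
have A0 : (0 <= A)%E by apply: integral_ge0 => t _; rewrite lee_fin sqr_ge0.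
have Afin : A \is a fin_num by rewrite ge0_fin_numE// (le_lt_trans hi)// ltry.
have AE : A = (fine A)%:E by rewrite fineK.
exists (fine A); split; last 2 first.
- by rewrite -lee_fin -AE.
- by rewrite -lee_fin -AE.
rewrite /L2norm unlock.
rewrite (_ : (\int[_]_t _)%E = A); last first.
  apply: eq_integral => t _; rewrite abse_EFin poweR_EFin powR_mulrn ?normr_ge0//.
  rewrite real_normK ?num_real// rk_sum_box; congr (_ ^+ 2)%:E.
  apply: eq_bigr => k _; rewrite rk_basis_box; congr (_ * _).
  by apply: eq_bigr => j _; rewrite /g hnE mxE.
by rewrite AE poweR_EFin powR12_sqrt ?fine_ge0.
Qed.
End box.

(** * Coercivity *)

Lemma ler_coord_norm (R : realType) (d : nat) (x : 'rV[R]_d) j : `|x 0 j| <= `|x|.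
Proof.
rewrite [leRHS]/Num.Def.normr/= mx_normrE; apply/bigmax_geP; right.
by exists (0, j).
Qed.

(** Used to count the doublings: the least power of two above [X] overshoots by at most a factor
    2. *)
Lemma exists_pow2 (R : realType) (X : R) : 1 <= X ->
  exists p : nat, X <= 2 ^+ p <= 2 * X.
Proof.
move=> X1; have [p Xp] : exists p : nat, X <= 2 ^+ p.
  exists (Num.truncn X).+1; apply: le_trans (ltW (truncnS_gt X)) _.
  by rewrite -natrX ler_nat ltnW// ltn_expl.
have exP : exists p, (X <= 2 ^+ p) by exists p.
case: (ex_minnP exP) => [[|q] Xq qmin]; [exists 0%N|exists q.+1].
  by rewrite Xq /= expr0; lra.
rewrite Xq exprS ler_pM2l//= leNgt; apply/negP => /ltW /qmin.
by rewrite ltnn.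
Qed.

Section coercivity.
Context (R : realType) (d N : nat) (rho : R -> R) (B : {fset 'rV[R]_d}).
Hypotheses (d_gt0 : (0 < d)%N) (rho_ge0 : forall r : R, 0 < r -> 0 <= rho r)
  (den_neq0 : weight_denominator rho B != 0).
Variables (h : 'rV[R]_d) (c : 'rV[int]_d -> R).
Hypotheses (h0 : forall j, 0 < h 0 j)
  (c0 : forall q, (forall k : d.-tuple 'I_(N.*2.+1), box_index k <> q) -> c q = 0).
Local Notation J := (d.-tuple 'I_(N.*2.+1)).

(** The shift by [N] in the nodes cancels in their differences. *)
Definition box_corr : ('I_d -> R) -> R :=
  autocorr (fun k : J => c (box_index k)) (fun k j => (tnth k j)%:R).

(** Pairing with [c] turns the increment of [u] along one offset into an increment of the
    autocorrelation. *)
Lemma sum_increment (v : 'rV[R]_d) :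
  \sum_(k : J) c (box_index k) *
    (rk_sum h c (grid_point h (box_index k) + v) -
     rk_sum h c (grid_point h (box_index k))) =
  box_corr (fun j => v 0 j / h 0 j) - box_corr (fun=> 0).
Proof.
have E (w : 'rV[R]_d) (k : J) : rk_sum h c (grid_point h (box_index k) + w) =
    \sum_(m : J) c (box_index m) *
      \prod_j bspline ((tnth k j)%:R - (tnth m j)%:R + w 0 j / h 0 j).
  rewrite (rk_sum_box h c0); apply: eq_bigr => m _; congr (_ * _).
  rewrite rk_basis_box//; apply: eq_bigr => j _; congr bspline.
  have hj : h 0 j != 0 by rewrite gt_eqF.
  by rewrite !mxE intrB; field.
rewrite -sumrB; apply: eq_bigr => k _.
rewrite -[in X in _ - X](addr0 (grid_point h (box_index k))) !E mulrBr !mulr_sumr.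
congr (_ - _); apply: eq_bigr => m _; rewrite mulrA; congr (_ * _).
by apply: eq_bigr => j _; rewrite mxE mul0r.
Qed.

(** The product over coordinates of the indicators of equality is the identity kernel on
    multi-indices, so the form of the difference kernel gives the bound. *)
Lemma box_corr0_ge : 3^-1 ^+ d * \sum_(k : J) c (box_index k) ^+ 2 <= box_corr (fun=> 0).
Proof.
have P := psd_prod_bspline_sub_eq (enum 'I_d) (fun (k : J) j => tnth k j)
  (fun k => c (box_index k)).
rewrite -subr_ge0; apply: le_trans P _.
rewrite le_eqVlt; apply/orP; left; apply/eqP.
rewrite /box_corr /autocorr mulr_sumr -sumrB; apply: eq_bigr => k _.
have -> : 3^-1 ^+ d * c (box_index k) ^+ 2 = \sum_(l : J)
    c (box_index k) * c (box_index l) * (3^-1 ^+ d * (k == l)%:R).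
  rewrite (bigD1 k)//= eqxx big1 => [|l /negbTE lk]; last by rewrite eq_sym lk !mulr0.
  by rewrite addr0 mulr1 mulrC -expr2.
rewrite -sumrB; apply: eq_bigr => l _; rewrite -mulrBr; congr (_ * _).
rewrite size_enum_ord !big_enum; congr (_ - _ * _).
  by apply: eq_bigr => j _; rewrite addr0.
have [->|kl] := eqVneq k l; first by rewrite big1// => j _; rewrite eqxx.
have [j kj] : exists j, tnth k j != tnth l j.
  apply: contrapT => Nj; case/eqP: kl; apply: eq_from_tnth => j.
  by apply/eqP; apply: contrapT => /negP kj; apply: Nj; exists j.
by rewrite (bigD1 j)//= (negbTE kj) mul0r.
Qed.

(** In coordinate [j] two indices of the box differ by at most [2 * N], so the shift moves every
    pair out of the support. *)
Lemma box_corr_far (y : 'I_d -> R) j : 2 * N%:R + 2 <= `|y j| -> box_corr y = 0.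
Proof.
move=> yj; rewrite /box_corr /autocorr big1// => k _; rewrite big1// => l _.
rewrite (bigD1 j)//= bspline_eq0 ?mul0r ?mulr0// addrC.
have bnd (i : 'I_(N.*2.+1)) : 0 <= (i%:R : R) <= 2 * N%:R.
  by rewrite ler0n /= -natrM ler_nat mul2n -ltnS.
have /andP[k1 k2] := bnd (tnth k j); have /andP[l1 l2] := bnd (tnth l j).
have : `|(tnth k j)%:R - (tnth l j)%:R| <= 2 * N%:R :> R by rewrite ler_norml; lra.
have := lerB_normD (y j) ((tnth k j)%:R - (tnth l j)%:R); lra.
Qed.

Lemma box_corr_coercive (y : 'I_d -> R) j p : 2 * N%:R + 2 <= 2 ^+ p * `|y j| ->
  3^-1 ^+ d * \sum_(k : J) c (box_index k) ^+ 2 <=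
  (2 ^+ p) ^+ 2 * (box_corr (fun=> 0) - box_corr y).
Proof.
move=> yp; apply: le_trans box_corr0_ge _.
have := autocorr_dyadic (fun k : J => c (box_index k)) (fun k j => (tnth k j)%:R) y p.
rewrite -!/(box_corr _) (@box_corr_far (fun l => 2 ^+ p * y l) j).
  rewrite subr0 => /le_trans; apply.
  by rewrite -exprM mulnC exprM (_ : 2 ^+ 2 = 4)// expr2; ring.
by rewrite normrM ger0_norm ?exprn_ge0.
Qed.

Lemma operator_coercive (delta : R) (s : 'rV[R]_d) j p : 0 < delta -> s \in B ->
  2 * N%:R + 2 <= 2 ^+ p * `|delta * s 0 j / h 0 j| ->
  2 * (weight rho B s * rho (enorm s)) * 3^-1 ^+ d / (2 ^+ p * delta) ^+ 2 *
    \sum_(k : J) c (box_index k) ^+ 2 <=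
  \sum_(k : J) c (box_index k) *
    - quasi_discrete_op rho B delta (rk_sum h c) (grid_point h (box_index k)).
Proof.
move=> delta0 sB sp; set S := \sum_k _.
pose a (t : 'rV[R]_d) := weight rho B t * rho (enorm t).
pose D (t : 'rV[R]_d) := box_corr (fun=> 0) - box_corr (fun j => delta * t 0 j / h 0 j).
have a0 t : 0 <= a t by exact: weight_rho_ge0.
have D0 t : 0 <= D t by rewrite subr_ge0 autocorr_le0.
have -> : \sum_(k : J) c (box_index k) *
    - quasi_discrete_op rho B delta (rk_sum h c) (grid_point h (box_index k)) =
    2 / delta ^+ 2 * \sum_(t <- B) a t * D t.
  transitivity (\sum_(k : J) \sum_(t <- B) 2 / delta ^+ 2 * (a t *
      - (c (box_index k) * (rk_sum h c (grid_point h (box_index k) + delta *: t) -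
          rk_sum h c (grid_point h (box_index k)))))).
    apply: eq_bigr => k _; rewrite quasi_discrete_opE// mulrN -mulNr !mulr_sumr.
    by apply: eq_bigr => t _; rewrite /a; ring.
  rewrite exchange_big mulr_sumr; apply: eq_bigr => t _ /=.
  rewrite -!mulr_sumr sumrN sum_increment opprB /D; congr (_ * (_ * (_ - _))).
  by apply: eq_autocorr => l; rewrite mxE.
have cs : 3^-1 ^+ d * S <= (2 ^+ p) ^+ 2 * D s.
  exact: (@box_corr_coercive (fun j => delta * s 0 j / h 0 j) j p sp).
(* All terms are nonnegative, so keeping the single point [s] loses only in size. *)
have aD : a s * D s <= \sum_(t <- B) a t * D t.
  rewrite (big_fsetD1 s)//= lerDl; apply: sumr_ge0 => t _; exact: mulr_ge0.
have e0 : 0 < 2 ^+ p :> R by rewrite exprn_gt0.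
have -> : 2 * (weight rho B s * rho (enorm s)) * 3^-1 ^+ d / (2 ^+ p * delta) ^+ 2 * S =
    2 / delta ^+ 2 * (a s * (3^-1 ^+ d * S / (2 ^+ p) ^+ 2)).
  move: e0; rewrite /a; set e := 2 ^+ p; set q := 3^-1 ^+ d => e0.
  by field; rewrite !gt_eqF.
apply: ler_wpM2l; first by rewrite divr_ge0 ?exprn_ge0 ?ltW.
apply: le_trans aD; apply: ler_wpM2l => //.
by rewrite ler_pdivrMr ?exprn_gt0// [D s * _]mulrC.
Qed.
End coercivity.

(** * Constants uniform in the mesh width, and the final estimate *)

Theorem theorem6p1 (R : realType) (d : nat) (rho : R -> R) (hhat : 'rV[R]_d)
    (B : {fset 'rV[R]_d}) :
  (0 < d)%N ->
  kernel_profile d rho ->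
  grid_ratio hhat ->
  quadrature_points B ->
  weight_denominator rho B != 0 ->
  forall (Omega : set 'rV[R]_d) (delta0 M0 : R),
    open Omega -> bounded_set Omega -> 0 < delta0 -> 0 < M0 ->
  exists2 C : R, 0 < C &
    forall hmax delta : R,
      0 < hmax -> delta = M0 * hmax -> 0 < delta -> delta <= delta0 ->
    forall u : 'rV[R]_d -> R,
      trial_space (hmax *: hhat) Omega u ->
      (C%:E * L2norm u <=
        seq_norm (hmax *: hhat)
          (grid_restriction (hmax *: hhat) Omega
             (fun x => (- quasi_discrete_op rho B delta u x)%R)))%E.
Proof.
move=> d_gt0 [rho_ge0 _ _ _] [hhat0 _] _ den0 Omega delta0 M0 _ bOmega delta0_gt0 M0_gt0.
have [D D_gt0 OmegaD] := pinfty_ex_gt0 bOmega.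
have [s [sB s_neq0 a_gt0]] := weight_rho_gt0 d_gt0 rho_ge0 den0.
have [j sj] : exists j, s 0 j != 0 by apply/rV0Pn.
set a := weight rho B s * rho (enorm s) in a_gt0.
(* This is the shift [delta * s / h] in coordinate [j]; [hmax] cancels because
   [delta = M0 * hmax]. *)
pose tau := M0 * `|s 0 j| / hhat 0 j.
have tau_gt0 : 0 < tau by rewrite divr_gt0// mulr_gt0 ?normr_gt0.
(* A common bound for all the [1 / hhat 0 i], so indices of grid points in [Omega] are at most
   [D * E / hmax] in absolute value. *)
pose E := \sum_i (hhat 0 i)^-1.
have E_ge i : (hhat 0 i)^-1 <= E.
  by rewrite /E (bigD1 i)//= lerDl sumr_ge0// => k _; rewrite invr_ge0 ltW.
have E_gt0 : 0 < E by apply: lt_le_trans (E_ge j); rewrite invr_gt0.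
(* A bound for [2 ^+ p * delta] free of [hmax]: it uses [2 ^+ p <= 2 * (1 + (2 * N + 2) / tau)],
   [N * hmax <= D * E + hmax] and [hmax <= delta0 / M0]. *)
pose Gamma := 2 * (delta0 + (2 * D * E + 4 * (delta0 / M0)) * M0 / tau).
have Gamma_gt0 : 0 < Gamma.
  have dM : 0 < delta0 / M0 by rewrite divr_gt0.
  have DE : 0 < D * E by rewrite mulr_gt0.
  rewrite mulr_gt0// addr_gt0// divr_gt0// mulr_gt0//; lra.
pose C0 := 2 * a * 3^-1 ^+ d / Gamma ^+ 2.
have e_gt0 : 0 < 3^-1 ^+ d :> R by apply: exprn_gt0; lra.
have C0_gt0 : 0 < C0 by apply: divr_gt0; rewrite ?exprn_gt0// mulr_gt0// mulr_gt0.
(* The ratio of the lower to the upper constant in the norm equivalence. *)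
pose q : R := (9 / 2000 / 16) ^+ d.
have q_gt0 : 0 < q by apply: exprn_gt0; lra.
exists (C0 * Num.sqrt q); first by rewrite mulr_gt0 ?sqrtr_gt0.
move=> hmax delta hmax_gt0 deltaE delta_gt0 delta_le u [c c_Omega ->].
set h := hmax *: hhat.
have h_gt0 i : 0 < h 0 i by rewrite mxE mulr_gt0.
pose N := (Num.truncn (D * E / hmax)).+1.
have DE_ge0 : 0 <= D * E / hmax by rewrite divr_ge0 ?mulr_ge0// ltW.
have N_gt : D * E / hmax < N%:R by exact: truncnS_gt.
have N_le : N%:R <= D * E / hmax + 1.
  by rewrite /N -natr1 lerD2r truncn_le.
have Omega_box k : Omega (grid_point h k) ->
    exists l : d.-tuple 'I_(N.*2.+1), box_index l = k.
  move=> /OmegaD /= kD; apply: box_index_surj => i.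
  rewrite -(ler_nat R) natr_absz intr_norm.
  have := le_trans (ler_coord_norm (grid_point h k) i) kD.
  rewrite mxE normrM (gtr0_norm (h_gt0 i)) -ler_pdivlMr// => /le_trans; apply.
  apply: le_trans (ltW N_gt); rewrite mxE -mulrA ler_pM2l//.
  by rewrite invfM mulrC ler_pM2r ?invr_gt0.
have supported (w : 'rV[int]_d -> R) : (forall k, ~ Omega (grid_point h k) -> w k = 0) ->
    forall k, (forall l : d.-tuple 'I_(N.*2.+1), box_index l <> k) -> w k = 0.
  move=> wO k kN; apply: wO => /Omega_box[l lk]; exact: kN lk.
set f := grid_restriction _ _ _.
have f_Omega k : ~ Omega (grid_point h k) -> f k = 0.
  by move=> kN; rewrite /f /grid_restriction patchE memNset.
have fE k : Omega (grid_point h k) ->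
    f k = - quasi_discrete_op rho B delta (rk_sum h c) (grid_point h k).
  by move=> kO; rewrite /f /grid_restriction patchE mem_set.
have [Qc [-> _ Qc_le]] := L2norm_rk_sum h_gt0 (supported c c_Omega).
have [Qf [Qf_eq Qf_ge _]] := L2norm_rk_sum h_gt0 (supported f f_Omega).
rewrite /seq_norm Qf_eq -EFinM lee_fin.
set Sc := \sum_k c _ ^+ 2 in Qc_le; set Sf := \sum_k f _ ^+ 2 in Qf_ge.
pose J := d.-tuple 'I_(N.*2.+1).
have coer : C0 * Sc <= \sum_(k : J) c (box_index k) * f (box_index k).
  (* The added 1 guarantees an admissible argument for [exists_pow2]. *)
  have X1 : 1 <= 1 + (2 * N%:R + 2) / tau.
    by rewrite lerDl divr_ge0 ?(ltW tau_gt0)// addr_ge0// mulr_ge0.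
  have [p /andP[p1 p2]] := exists_pow2 X1.
  have tauE : `|delta * s 0 j / h 0 j| = tau.
    rewrite deltaE mxE !normrM normfV normrM (gtr0_norm M0_gt0) (gtr0_norm hmax_gt0).
    rewrite (gtr0_norm (hhat0 j)) /tau.
    by field; rewrite !gt_eqF.
  have ptau : 2 * N%:R + 2 <= 2 ^+ p * `|delta * s 0 j / h 0 j|.
    by rewrite tauE -ler_pdivrMr//; lra.
  have := operator_coercive d_gt0 rho_ge0 h_gt0 (supported c c_Omega) delta_gt0 sB ptau.
  rewrite -/a -/Sc => H; apply: (@le_trans _ _ (2 * a * 3^-1 ^+ d / (2 ^+ p * delta) ^+ 2 * Sc)).
    apply: ler_wpM2r; first by apply: sumr_ge0 => k _; exact: sqr_ge0.
    apply: ler_wpM2l; first by rewrite ltW// mulr_gt0// mulr_gt0.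
    have pd_gt0 : 0 < 2 ^+ p * delta by rewrite mulr_gt0 ?exprn_gt0.
    rewrite lef_pV2 ?posrE ?exprn_gt0// lerXn2r ?nnegrE ?(ltW pd_gt0) ?(ltW Gamma_gt0)//.
    apply: (le_trans (ler_wpM2r (ltW delta_gt0) p2)).
    have hd : hmax <= delta0 / M0 by rewrite ler_pdivlMr// mulrC -deltaE.
    have Nh : N%:R * hmax <= D * E + hmax.
      rewrite -[X in _ <= X + _](divfK (lt0r_neq0 hmax_gt0)).
      by rewrite -[X in _ <= _ + X]mul1r -mulrDl ler_pM2r.
    have key : (2 * N%:R + 2) * hmax <= 2 * D * E + 4 * (delta0 / M0) by lra.
    have := ler_wpM2r (ltW (divr_gt0 M0_gt0 tau_gt0)) key.
    have -> : 2 * (1 + (2 * N%:R + 2) / tau) * delta =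
        2 * (delta + (2 * N%:R + 2) * hmax * (M0 / tau)) by rewrite deltaE; ring.
    rewrite /Gamma mulrA => K; lra.
  (* The coefficients vanish off [Omega], so in the pairing [- L u] may be replaced by its
     restriction [f]. *)
  apply: le_trans H _; rewrite le_eqVlt; apply/orP; left; apply/eqP.
  apply: eq_bigr => k _; case: (pselect (Omega (grid_point h (box_index k)))) => kO.
    by rewrite fE.
  by rewrite c_Omega// !mul0r.
have SfSc : C0 ^+ 2 * Sc <= Sf.
  (* Summing [(f - C0 * c) ^+ 2 >= 0] takes the place of Cauchy-Schwarz and of a division by the
     norm of [c]. *)
  have : 2 * C0 * (\sum_(k : J) c (box_index k) * f (box_index k)) - C0 ^+ 2 * Sc <= Sf.
    rewrite /Sf /Sc !mulr_sumr -sumrB; apply: ler_sum => k _.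
    have := sqr_ge0 (f (box_index k) - C0 * c (box_index k)); lra.
  have := ler_wpM2l (ltW C0_gt0) coer; lra.
have H_ge0 : 0 <= \prod_i h 0 i by apply: prodr_ge0 => i _; exact: ltW.
rewrite -[C0](gtr0_norm C0_gt0) -sqrtr_sqr -sqrtrM ?sqr_ge0// -sqrtrM; last first.
  by rewrite mulr_ge0 ?sqr_ge0// ltW.
apply: ler_wsqrtr; apply: le_trans Qf_ge.
(* The cell volume [\prod_i h 0 i] occurs in both norm bounds, so the constant does not depend on
   it. *)
apply: (@le_trans _ _ (C0 ^+ 2 * q * (16 ^+ d * (\prod_i h 0 i) * Sc))).
  by apply: ler_wpM2l => //; rewrite mulr_ge0 ?sqr_ge0// ltW.
have -> : (9 / 2000) ^+ d = q * 16 ^+ d :> R.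
  by rewrite -exprMn; congr (_ ^+ _); field.
have := ler_wpM2l (mulr_ge0 (mulr_ge0 (ltW q_gt0) (exprn_ge0 d (ler0n R 16))) H_ge0) SfSc.
set e := 16 ^+ d; lra.
Qed.
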